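(* Let $\mathcal{D}=\{(\Sigma_k,L_k,G_k)\}_{k\in\mathbb{N}}$ be a treelike decomposition class of arity $r$ and of complexity $f:\mathbb{N}\to\mathbb{N}$. Let $C_1,\dots,C_m$ be finite, internally polynomial, $\mathcal{D}$-coherent treelike DP-cores, and let $c$ be a polynomial $m$-combinator. Let $C=C(c,C_1,\dots,C_m)$ be the $c$-combination of $C_1,\dots,C_m$, let $\beta(k)=\max_i \beta_{C_i}(k)$ and $\mu(k)=\max_i \mu_{C_i}(k)$. Then for each $k\in\mathbb{N}$, one can determine whether $P(\mathcal{D}_k)\subseteq P(C,\mathcal{D})$ in time $$f(k)^{O(r)}\cdot 2^{O(m\cdot r\cdot \beta(k)\cdot\mu(k))}\;\le\; f(k)^{O(r)}\cdot 2^{m\cdot r\cdot 2^{O(\beta(k))}}.$$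
   Context: Graphs: a graph is a triple $G=(V,E,I)$ with $V,E$ finite subsets of $\mathbb{N}$ and $I\subseteq E\times V$ an incidence relation (multi-edges allowed). An isomorphism is a pair of bijections on vertices and on edges preserving incidence; write $G\simeq H$. A graph property is a set of graphs closed under isomorphism; the isomorphism closure of a set $S$ of graphs is the set of all graphs isomorphic to a member of $S$. For a graph property $P$ and graph $G$, $P(G)\in\{0,1\}$ is $1$ iff $G\in P$. A ranked alphabet is a finite set of symbols each with an arity in $\mathbb{N}$; a term over $\Sigma$ is a finite rooted ordered tree whose nodes are labelled by symbols whose arity equals the number of children; $|\tau|$ is the number of nodes; $\mathrm{Terms}(\Sigma)$ is the set of terms. Tree automata and regular tree languages are as usual. Treelike decomposition class of arity $r$: a sequence $\mathcal{D}=\{(\Sigma_k,L_k,G_k)\}_{k\in\mathbb{N}}$ where $\Sigma_k$ is a ranked alphabet whose symbols have arity at most $r$, $L_k\subseteq\mathrm{Terms}(\Sigma_k)$ is a regular tree language, $G_k:L_k\to\{\text{graphs}\}$, and $\Sigma_k\subseteq\Sigma_{k+1}$, $L_k\subseteq L_{k+1}$, $G_{k+1}|_{L_k}=G_k$. Write $G(\tau)$ for $G_k(\tau)$. $P(\mathcal{D}_k)$ is the isomorphism closure of $\{G(\tau):\tau\in L_k\}$. An automation of $\mathcal{D}$ is a sequence of tree automata $A_k$ with language $L_k$; it has complexity $f$ if $A_k$ has at most $f(k)$ states and can be constructed from $k$ in time $k^{O(1)}f(k)^{O(r)}$; $\mathcal{D}$ has complexity $f$ if it has such an automation. Treelike DP-core: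 a sequence $C=\{C[k]\}_{k}$ with $C[k]=(\Sigma_k,W_k,F_k,T_k,\mathrm{Clean}_k,\mathrm{Inv}_k)$: $\Sigma_k$ a ranked alphabet; $W_k\subseteq\{0,1\}^*$ decidable (local witnesses); $F_k:W_k\to\{0,1\}$ ($w$ is final if $F_k(w)=1$); $T_k$ contains, for each symbol $a$ of arity $0$, a finite set $\hat a\subseteq W_k$, and for each symbol $a$ of arity $p\ge1$, a function $\hat a:W_k^{p}\to$ finite subsets of $W_k$; $\mathrm{Clean}_k$ maps finite subsets of $W_k$ to finite subsets of $W_k$; $\mathrm{Inv}_k$ maps finite subsets of $W_k$ to $\{0,1\}^*$. For $a$ of arity $p\ge1$ and finite $S_1,\dots,S_p\subseteq W_k$, $\hat a(S_1,\dots,S_p)=\mathrm{Clean}_k\big(\bigcup_{w_i\in S_i}\hat a(w_1,\dots,w_p)\big)$. The $k$-th dynamization $\mathrm{Dyn}_k:\mathrm{Terms}(\Sigma_k)\to$ finite subsets of $W_k$ is $\mathrm{Dyn}_k(a)=\hat a$ for $a$ of arity $0$ and $\mathrm{Dyn}_k(a(\tau_1,\dots,\tau_p))=\hat a(\mathrm{Dyn}_k(\tau_1),\dots,\mathrm{Dyn}_k(\tau_p))$. A term $\tau$ is accepted by $C[k]$ if $\mathrm{Dyn}_k(\tau)$ contains a final witness. $P(C[k],\mathcal{D})$ is the isomorphism closure of $\{G(\tau):\tau\in L_k,\ \tau \text{ accepted by } C[k]\}$ and $P(C,\mathcal{D})=\bigcup_k P(C[k],\mathcal{D})$. $C$ is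 $\mathcal{D}$-coherent if $C[k]$ has alphabet $\Sigma_k$ for all $k$ and for all $k,k'$, $\tau\in L_k$, $\tau'\in L_{k'}$ with $G(\tau)\simeq G(\tau')$: (i) $\tau$ is accepted by $C[k]$ iff $\tau'$ is accepted by $C[k']$; (ii) $\mathrm{Inv}_k(\mathrm{Dyn}_k(\tau))=\mathrm{Inv}_{k'}(\mathrm{Dyn}_{k'}(\tau'))$. For coherent $C$, the invariant $\mathrm{Inv}[C,\mathcal{D}]$ maps $G\in P(C,\mathcal{D})$ to $\mathrm{Inv}_{k}(\mathrm{Dyn}_{k}(\tau))$ for any $\tau$ with $G(\tau)\simeq G$, $k$ its width (least $k$ with $\tau\in L_k$). Complexity measures: a set $S\subseteq W_k$ is $(C,k,n)$-useful if $S=\mathrm{Dyn}_k(\tau)$ for some $\tau\in\mathrm{Terms}(\Sigma_k)$ with $|\tau|\le n$; a witness is useful if it lies in a useful set. $\beta_C(k,n)$ (bitlength) is the maximum length of a useful witness; $\mu_C(k,n)$ (multiplicity) the maximum size of a useful set; $\nu_C(k,n)$ the number of useful witnesses; $\delta_C(k,n)$ the number of useful sets. $C$ is finite if there is $g$ with $\beta_C(k,n)\le g(k)$ for all $n$; then one writes $\beta_C(k)$, $\mu_C(k)$, $\nu_C(k)$, $\delta_C(k)$. $C$ is internally polynomial if (1) for every useful set $S$, $|\mathrm{Inv}_k(S)|=\beta_C(k,n)^{O(1)}$, and (2) there is a deterministic algorithm that decides $w\in W_k$ in time $(k+|w|)^{O(1)}$, constructs $\hat a$ for arity-$0$ symbols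 in time $\beta_C(k,0)\cdot\mu_C(k,0)$, computes $\hat a(X)$ in time $(k+|X|)^{O(1)}$, and computes $F_k$, $\mathrm{Clean}_k$, $\mathrm{Inv}_k$ on input $X$ in time $(k+|X|)^{O(1)}$. Combinators: an $m$-combinator is a function $c:\{0,1\}^m\times(\{0,1\}^* )^m\to\{0,1\}$; it is polynomial if computable in time $O_m(|X|^{c_0})$ for a constant $c_0$. For graph properties $P_i$ and invariants $\varphi_i$, $\hat c(P_1,\dots,P_m,\varphi_1,\dots,\varphi_m)=\{G: c(P_1(G),\dots,P_m(G),\varphi_1(G),\dots,\varphi_m(G))=1\}$. The $c$-combination $C(c,C_1,\dots,C_m)$ is the DP-core whose witnesses at level $k$ are tuples $(S_1,\dots,S_m)$ of finite sets $S_i\subseteq W^{C_i}_k$, whose transitions act componentwise by the set-extended transitions of the $C_i$ (producing singletons; the leaf set is $\{(\hat a^{C_1},\dots,\hat a^{C_m})\}$), whose clean function applies $\mathrm{Clean}^{C_i}_k$ componentwise, whose final-witness function is $c(F(C_1,S_1),\dots,F(C_m,S_m),\mathrm{Inv}^{C_1}_k(S_1),\dots,\mathrm{Inv}^{C_m}_k(S_m))$ where $F(C_i,S_i)=1$ iff $S_i$ contains a final witness of $C_i$, and whose invariant function is the tuple of the $\mathrm{Inv}^{C_i}_k(S_i)$.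
   Formalization: The time bound of the uniform algorithm has an extra factor k^{O(1)}; the displayed bound without it is proved only for an algorithm that may depend on the fixed data. In the c-combination, Clean of each component is applied once per step, not twice. O(r) is read as O(max(1,r)). *)

(* Defs.v *)
(* MathComp world (with finmap, and mathcomp-classical for maxima of sets). *)
From Stdlib Require List.
From mathcomp Require Import all_boot finmap.
From mathcomp Require Import boolp classical_sets.

Set Implicit Arguments.
Unset Strict Implicit.
Unset Printing Implicit Defensive.

Local Open Scope nat_scope.
Local Open Scope fset_scope.

Definition word := seq bool.

(** * Graphs *)

Record graph := Graph {
  vertices : {fset nat};
  edges : {fset nat};
  incidence : {fset nat * nat};
  incidenceP : forall x, x \in incidence ->
    (x.1 \in edges) && (x.2 \in vertices)
}.

Definition bij_on (A B : {fset nat}) (h : nat -> nat) : Prop :=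
  {in A &, injective h} /\ [fset h x | x in A] = B.

Definition graph_iso (G H : graph) : Prop :=
  exists phi psi : nat -> nat,
    [/\ bij_on (vertices G) (vertices H) phi,
        bij_on (edges G) (edges H) psi &
        forall e v, e \in edges G -> v \in vertices G ->
          ((e, v) \in incidence G) = ((psi e, phi v) \in incidence H)].

Definition iso_closure (S : graph -> Prop) : graph -> Prop :=
  fun G => exists2 H, S H & graph_iso G H.

(** * Terms and tree automata *)

(* A ranked symbol is a name together with its arity. *)
Definition symbol := (word * nat)%type.
Definition arity (a : symbol) : nat := a.2.

Inductive term := Node of symbol & seq term.

Fixpoint term_size (t : term) : nat :=
  let: Node _ ts := t in (sumn (map term_size ts)).+1.

Fixpoint in_terms (Sigma : {fset symbol}) (t : term) : bool :=
  let: Node a ts := t in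
  [&& a \in Sigma, size ts == arity a & all (in_terms Sigma) ts].

(* Nondeterministic bottom-up automata; the states are 0, ..., nstates - 1, and
   the rule ((a, [:: q1; ...; qp]), q) stands for a(q1, ..., qp) -> q. *)
Definition ta_rule := (symbol * seq nat * nat)%type.

Record tree_automaton := TreeAutomaton {
  nstates : nat;
  final_states : seq nat;
  rules : seq ta_rule
}.

Definition ta_over (Sigma : {fset symbol}) (A : tree_automaton) : bool :=
  all (fun q => q < nstates A) (final_states A) &&
  all (fun rho : ta_rule =>
         [&& rho.1.1 \in Sigma, size rho.1.2 == arity rho.1.1,
             all (fun q => q < nstates A) rho.1.2 & rho.2 < nstates A])
      (rules A).

Fixpoint reaches (A : tree_automaton) (t : term) (q : nat) : bool :=
  let: Node a ts := t in
  has (fun rho : ta_rule =>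
         [&& rho.1.1 == a, all2 (reaches A) ts rho.1.2 & rho.2 == q])
      (rules A).

Definition ta_language (A : tree_automaton) (t : term) : bool :=
  has (reaches A t) (final_states A).

(** * Treelike decomposition classes *)

Record decomposition := Decomposition {
  d_sigma : nat -> {fset symbol};
  d_lang : nat -> term -> Prop;
  (* only the values of d_graph k on d_lang k are meaningful *)
  d_graph : nat -> term -> graph
}.

Definition recognizes (D : decomposition) (k : nat) (A : tree_automaton) :=
  ta_over (d_sigma D k) A /\ forall t, d_lang D k t <-> ta_language A t.

Record treelike_class (r : nat) (D : decomposition) : Prop := {
  tc_arity : forall k a, a \in d_sigma D k -> arity a <= r;
  tc_terms : forall k t, d_lang D k t -> in_terms (d_sigma D k) t;
  tc_regular : forall k, exists A, recognizes D k A;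
  tc_sigma_mono : forall k, d_sigma D k `<=` d_sigma D k.+1;
  tc_lang_mono : forall k t, d_lang D k t -> d_lang D k.+1 t;
  tc_graph_ext : forall k t, d_lang D k t -> d_graph D k.+1 t = d_graph D k t
}.

Definition class_property (D : decomposition) (k : nat) : graph -> Prop :=
  iso_closure (fun G => exists2 t, d_lang D k t & G = d_graph D k t).

(** * Treelike DP-cores *)

(* The type T of witnesses and the type V of invariant values are parameters:
   both are [word] for ordinary DP-cores, while a combination has tuples. The
   functions are total, but only their values on witnesses in [wit k] and on
   finite sets of such witnesses matter. [trans k a [:: w1; ...; wp]] is the set
   attached to a and (w1, ..., wp); [trans k a [::]] is the set attached to a
   symbol a of arity 0. *)
Record dp_core (T : choiceType) (V : Type) := DPCore {
  sigma : nat -> {fset symbol};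
  wit : nat -> pred T;
  final : nat -> T -> bool;
  trans : nat -> symbol -> seq T -> {fset T};
  clean : nat -> {fset T} -> {fset T};
  inv : nat -> {fset T} -> V
}.

Section DPCore.
Variables (T : choiceType) (V : Type) (C : dp_core T V).

Definition wit_set (k : nat) (S : {fset T}) : Prop := {subset S <= wit C k}.

Definition treelike_dp_core : Prop :=
  (forall k a ws, a \in sigma C k -> size ws = arity a ->
     all (wit C k) ws -> wit_set k (trans C k a ws)) /\
  (forall k S, wit_set k S -> wit_set k (clean C k S)).

Fixpoint choices (Ss : seq {fset T}) : seq (seq T) :=
  if Ss is X :: Ss' then
    [seq w :: ws | w <- enum_fset X, ws <- choices Ss']
  else [:: [::]].

Definition union_trans (k : nat) (a : symbol) (Ss : seq {fset T}) : {fset T} :=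
  \big[@fsetU T/fset0]_(ws <- choices Ss) trans C k a ws.

Definition set_trans (k : nat) (a : symbol) (Ss : seq {fset T}) : {fset T} :=
  if Ss is [::] then trans C k a [::] else clean C k (union_trans k a Ss).

Fixpoint Dyn (k : nat) (t : term) : {fset T} :=
  let: Node a ts := t in set_trans k a (map (Dyn k) ts).

Definition has_final (k : nat) (S : {fset T}) : bool := has (final C k) S.

Definition accepted (k : nat) (t : term) : bool := has_final k (Dyn k t).

Definition level_property (D : decomposition) (k : nat) : graph -> Prop :=
  iso_closure
    (fun G => exists2 t, d_lang D k t /\ accepted k t & G = d_graph D k t).

Definition core_property (D : decomposition) (G : graph) : Prop :=
  exists k, level_property D k G.

Definition coherent (D : decomposition) : Prop :=
  (forall k, sigma C k = d_sigma D k) /\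
  forall k k' t t', d_lang D k t -> d_lang D k' t' ->
    graph_iso (d_graph D k t) (d_graph D k' t') ->
    accepted k t = accepted k' t' /\
    inv C k (Dyn k t) = inv C k' (Dyn k' t').

Definition useful_set (k n : nat) (S : {fset T}) : Prop :=
  exists t, [/\ in_terms (sigma C k) t, term_size t <= n & S = Dyn k t].

Definition useful_wit (k n : nat) (w : T) : Prop :=
  exists2 S, useful_set k n S & w \in S.

End DPCore.

(* The maximum of A, and 0 when A is empty (or unbounded). *)
Definition natmax (A : nat -> Prop) : nat :=
  xget 0 (fun b => A b /\ forall a, A a -> a <= b).

Definition core := dp_core word word.

(* bitlength C k n is finite for fixed n, because only finitely many terms have
   at most n nodes; for a finite core, the versions without n are the maxima
   over all n. *)
Definition bitlength (C : core) (k n : nat) : nat :=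
  natmax (fun b => exists2 w, useful_wit C k n w & b = size w).
Definition multiplicity (C : core) (k n : nat) : nat :=
  natmax (fun b => exists2 S, useful_set C k n S & b = #|` S|).

Definition finite_core (C : core) : Prop :=
  exists g : nat -> nat, forall k n, bitlength C k n <= g k.

Definition bitlength_sup (C : core) (k : nat) : nat :=
  natmax (fun b => exists n, b = bitlength C k n).
Definition multiplicity_sup (C : core) (k : nat) : nat :=
  natmax (fun b => exists n, b = multiplicity C k n).

(** * Combinators *)

Definition combinator (m : nat) := m.-tuple bool -> m.-tuple word -> bool.

(* [Sigma] is the common alphabet of the cores [C i]. The componentwise
   transition takes the union over all choices w_i \in S_i; the clean functions
   of the components are applied by the clean function of the combination, so
   that its set-extended transition acts on tuples of sets exactly as the
   set-extended transitions of the components, each with one cleaning step. The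
   invariant is only meaningful on singletons, which are the only sets produced
   by the dynamization. *)
Definition combination (Sigma : nat -> {fset symbol}) (m : nat)
    (c : combinator m) (C : 'I_m -> core) :
    dp_core (m.-tuple {fset word}) (m.-tuple word) := {|
  sigma := Sigma;
  wit := fun k (w : m.-tuple {fset word}) =>
    [forall i, all (wit (C i) k) (tnth w i)];
  final := fun k (w : m.-tuple {fset word}) =>
    c [tuple has_final (C i) k (tnth w i) | i < m]
      [tuple inv (C i) k (tnth w i) | i < m];
  trans := fun k a (ws : seq (m.-tuple {fset word})) =>
    [fset [tuple union_trans (C i) k a [seq tnth w i | w <- ws] | i < m]];
  clean := fun k (X : {fset m.-tuple {fset word}}) =>
    [fset [tuple clean (C i) k (tnth w i) | i < m] | w in X];
  inv := fun k (X : {fset m.-tuple {fset word}}) =>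
    let w := head [tuple fset0 | i < m] (enum_fset X) in
    [tuple inv (C i) k (tnth w i) | i < m]
|}.

Lemma term_nested_ind (P : term -> Prop) :
  (forall a ts, (forall t, List.In t ts -> P t) -> P (Node a ts)) ->
  forall t, P t.
Proof.
move=> H; fix IH 1 => -[a ts]; apply: H.
elim: ts => [|t ts IHts] u /=; first by case.
by case=> [<-|Hu]; [apply: IH|apply: IHts].
Qed.
Lemma Dyn_combination Sigma m (c : combinator m) (C : 'I_m -> core) k t :
  Dyn (combination Sigma c C) k t = [fset [tuple Dyn (C i) k t | i < m]].
Proof.
elim/term_nested_ind: t => a ts IH /=.
have -> : map (Dyn (combination Sigma c C) k) ts =
   map (fun t => [fset [tuple Dyn (C i) k t | i < m]]) ts.
  elim: ts IH => //= t ts IHts IH; rewrite IH; last by left.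
  by rewrite IHts // => u Hu; apply: IH; right.
have cho : choices [seq [fset [tuple Dyn (C i) k t | i < m]] | t <- ts] =
   [:: [seq [tuple Dyn (C i) k t | i < m] | t <- ts]].
  elim: ts {IH} => //= t ts ->; by rewrite enum_fsetE /= enum_fset1.
case: ts cho {IH} => [_|t ts cho] /=.
  congr [fset _]; apply: eq_from_tnth => i; rewrite !tnth_mktuple.
  by rewrite /union_trans /= big_seq1.
rewrite /union_trans cho big_seq1 /= imfset_fset1 /=.
congr [fset _]; apply: eq_from_tnth => i; rewrite !tnth_mktuple /=.
congr (clean _ _ _); rewrite /union_trans -map_comp.
by congr (\big[_/_]_(_ <- choices (_ :: _)) _); apply: eq_map => u /=; rewrite tnth_mktuple.
Qed.

(** * Model of computation

    Algorithms are closed terms of the weak call-by-value lambda calculus (with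
    de Bruijn indices), and data are Scott-encoded. The number of beta steps is
    a reasonable time measure: this model and Turing machines simulate each
    other with polynomial overhead (Forster, Kunze and Roth, The weak
    call-by-value lambda-calculus is reasonable for both time and space, 2020). *)

Inductive lam := Var of nat | App of lam & lam | Lam of lam.

Fixpoint closed_at (d : nat) (s : lam) : bool :=
  match s with
  | Var n => n < d
  | App s t => closed_at d s && closed_at d t
  | Lam s => closed_at d.+1 s
  end.

Definition procedure (s : lam) : bool :=
  if s is Lam s' then closed_at 1 s' else false.

(* No lifting is needed, since u is always closed. *)
Fixpoint subst (s : lam) (n : nat) (u : lam) : lam :=
  match s with
  | Var i => if i == n then u else Var i
  | App s t => App (subst s n u) (subst t n u)
  | Lam s => Lam (subst s n.+1 u)
  end.

(* eval n s v: s evaluates to the value v in exactly n beta steps. *)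
Inductive eval : nat -> lam -> lam -> Prop :=
| eval_lam s : eval 0 (Lam s) (Lam s)
| eval_app s t b u v i j l :
    eval i s (Lam b) -> eval j t u -> eval l (subst b 0 u) v ->
    eval (i + j + l).+1 (App s t) v.

Fixpoint lam_size (s : lam) : nat :=
  match s with
  | Var n => n.+1
  | App s t => (lam_size s + lam_size t).+1
  | Lam s => (lam_size s).+1
  end.

(* s outputs v in time at most t; as for Turing machines, the time includes the
   cost of writing the output. *)
Definition outputs (t : nat) (s v : lam) : Prop :=
  exists2 n, eval n s v & n + lam_size v <= t.

Definition apps (s : lam) (args : seq lam) : lam := foldl App s args.

Definition enc_bool (b : bool) : lam :=
  if b then Lam (Lam (Var 1)) else Lam (Lam (Var 0)).

Fixpoint enc_nat (n : nat) : lam :=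
  if n is n'.+1 then Lam (Lam (App (Var 0) (enc_nat n')))
  else Lam (Lam (Var 1)).

Definition enc_tuple (xs : seq lam) : lam := Lam (apps (Var 0) xs).

Fixpoint enc_seq (xs : seq lam) : lam :=
  if xs is x :: xs' then Lam (Lam (apps (Var 0) [:: x; enc_seq xs']))
  else Lam (Lam (Var 1)).

Definition enc_word (w : word) : lam := enc_seq (map enc_bool w).

Definition enc_words (ws : seq word) : lam := enc_seq (map enc_word ws).

Definition enc_symbol (a : symbol) : lam :=
  enc_tuple [:: enc_word a.1; enc_nat a.2].

Definition enc_rule (rho : ta_rule) : lam :=
  enc_tuple [:: enc_symbol rho.1.1; enc_seq (map enc_nat rho.1.2);
                enc_nat rho.2].

Definition enc_automaton (A : tree_automaton) : lam :=
  enc_tuple [:: enc_nat (nstates A); enc_seq (map enc_nat (final_states A));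
                enc_seq (map enc_rule (rules A))].

(* A finite set of words is presented as a duplicate-free list of its elements,
   in any order. *)
Definition lists (ws : seq word) (S : {fset word}) : bool :=
  perm_eq ws (enum_fset S).

Definition outputs_set (t : nat) (s : lam) (S : {fset word}) : Prop :=
  exists2 ws, lists ws S & outputs t s (enc_words ws).

Definition words_size (ws : seq word) : nat := \sum_(w <- ws) (size w).+1.
Definition symbol_size (a : symbol) : nat := size a.1 + arity a.

Definition decides_in (t : nat) (s : lam) (Q : Prop) : Prop :=
  exists2 b : bool, (b <-> Q) & outputs t s (enc_bool b).

(** * Effective versions of the notions above

    The constants hidden in the O-notation of a hypothesis are bounded by an
    explicit number e: an expression n^O(1) is read as [poly e n]. The number k
    is given in unary. *)

Definition poly (e n : nat) : nat := e * n.+1 ^ e.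

(* pA computes an automation A of D of complexity f for arity r. The maximum
   with 1 only matters in the degenerate case r = 0. *)
Definition automation_with (e r : nat) (f : nat -> nat) (D : decomposition)
    (A : nat -> tree_automaton) (pA : lam) : Prop :=
  procedure pA /\
  forall k,
    [/\ recognizes D k (A k), nstates (A k) <= f k &
        outputs (poly e k * f k ^ (e * maxn 1 r))
          (App pA (enc_nat k)) (enc_automaton (A k))].

Record core_program := CoreProgram {
  p_wit : lam;
  p_leaf : lam;
  p_trans : lam;
  p_final : lam;
  p_clean : lam;
  p_inv : lam
}.

Definition core_procedures (p : core_program) : seq lam :=
  [:: p_wit p; p_leaf p; p_trans p; p_final p; p_clean p; p_inv p].

Record internally_polynomial_with (e : nat) (C : core) (p : core_program) :
    Prop := {
  ip_inv_size : forall k n S, useful_set C k n S ->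
    size (inv C k S) <= poly e (bitlength C k n);
  ip_procedures : all procedure (core_procedures p);
  ip_wit : forall k w,
    outputs (poly e (k + size w)) (apps (p_wit p) [:: enc_nat k; enc_word w])
      (enc_bool (wit C k w));
  (* the least terms have one node, hence the bounds at n = 1 *)
  ip_leaf : forall k a, a \in sigma C k -> arity a = 0 ->
    outputs_set
      (poly e (k + symbol_size a + bitlength C k 1 * multiplicity C k 1))
      (apps (p_leaf p) [:: enc_nat k; enc_symbol a])
      (trans C k a [::]);
  ip_trans : forall k a ws, a \in sigma C k -> 0 < arity a ->
    size ws = arity a -> all (wit C k) ws ->
    outputs_set (poly e (k + symbol_size a + words_size ws))
      (apps (p_trans p) [:: enc_nat k; enc_symbol a; enc_words ws])
      (trans C k a ws);
  ip_final : forall k w, wit C k w ->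
    outputs (poly e (k + size w)) (apps (p_final p) [:: enc_nat k; enc_word w])
      (enc_bool (final C k w));
  ip_clean : forall k S ws, wit_set C k S -> lists ws S ->
    outputs_set (poly e (k + words_size ws))
      (apps (p_clean p) [:: enc_nat k; enc_words ws]) (clean C k S);
  ip_inv : forall k S ws, wit_set C k S -> lists ws S ->
    outputs (poly e (k + words_size ws))
      (apps (p_inv p) [:: enc_nat k; enc_words ws]) (enc_word (inv C k S))
}.

Definition polynomial_combinator_with (e m : nat) (c : combinator m) (pc : lam) :
    Prop :=
  procedure pc /\
  forall (b : m.-tuple bool) (x : m.-tuple word),
    outputs (poly e (m + words_size x))
      (apps pc [:: enc_seq (map enc_bool b); enc_words x]) (enc_bool (c b x)).

Definition enc_core_programs (m : nat) (p : 'I_m -> core_program) : lam :=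
  enc_seq [seq enc_tuple (core_procedures (p i)) | i <- enum 'I_m].

(* Main.v *)
(* An instance of the inclusion fails at level k exactly when some term of L_k is
   rejected: by coherence, acceptance depends only on the graph of a term. The
   terms of L_k are explored by saturation. An entry consists of a state q of the
   automaton A_k and of one list of witnesses for each core, namely the values
   Dyn(t) at a common term t that reaches q. Starting from nothing, every rule of
   A_k is applied to all the choices of entries for its children until no new
   entry appears, and then the entries with a final state are tested with the
   combinator. There are at most f(k) 2^(m (beta+1) mu) entries, hence at most the
   r-th power of this number of choices, and each choice costs a polynomial.

   For fixed data no computation is needed at all: the inclusion at level k + 1
   implies the inclusion at level k, so that comparing k with a constant is
   enough. *)
Require Import Defs.
From mathcomp Require Import all_boot zify finmap boolp classical_sets.

Set Implicit Arguments.
Unset Strict Implicit.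
Unset Printing Implicit Defensive.

Local Open Scope nat_scope.

(** * Weak call-by-value programs and their cost *)

(** The order of the quantifiers dictates the bookkeeping: the algorithm precedes all data, the
    exponent [K] may depend only on [e], and the factor [a] is chosen after the data. So every cost
    is measured by a power, with an absolute exponent, of one number B that bounds all sizes. B is
    then shown to be polynomial in [growth], of a degree that depends on [e] alone, and factors that
    depend only on m and r, such as 2^(m r), go into [a]. The multiplicity bounds sets only after
    cleaning, whereas the cleaning program receives the raw union. That union is controlled because
    writing an output takes time: the running time of the transitions bounds the number and the
    length of the witnesses that they produce. This is the origin of the successive budgets. The
    core programs list sets in an unspecified order and are specified only on witnesses. The lists
    that they output are therefore turned into functions by choice, and their runs are guaranteed
    only on arguments that come from terms. *)

Lemma closed_at_subst s d n u : closed_at d s -> d <= n -> subst s n u = s.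
Proof.
elim: s d n => [i|s IHs t IHt|s IHs] d n /=.
- by move=> lt_id le_dn; case: eqP => // eq_in; lia.
- by case/andP=> hs ht le_dn; rewrite (IHs d) // (IHt d).
- by move=> hs le_dn; rewrite (IHs d.+1).
Qed.

Lemma closed_at_weak s d d' : closed_at d s -> d <= d' -> closed_at d' s.
Proof.
elim: s d d' => [i|s IHs t IHt|s IHs] d d' /=.
- by lia.
- by case/andP=> hs ht le_dd; rewrite (IHs d) // (IHt d).
- by move=> hs le_dd; rewrite (IHs d.+1).
Qed.

Record cval := CVal { vl : lam; vlP : procedure vl }.

Lemma cval_lam v : exists b, vl v = Lam b.
Proof. by case: v => -[] //= b; exists b. Qed.

Lemma cval_closed v d : closed_at d (vl v).
Proof. by case: v => -[] //= b hb; apply: closed_at_weak hb _. Qed.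

(* Terms with closed values as constants: substitution stops at a constant, so
   that it computes even when the constants are variables. *)
Inductive tm := V of nat | A of tm & tm | L of tm | C of cval.

Fixpoint tmlam (s : tm) : lam :=
  match s with
  | V n => Var n
  | A s t => App (tmlam s) (tmlam t)
  | L s => Lam (tmlam s)
  | C v => vl v
  end.

Fixpoint tsubst (s : tm) (n : nat) (u : tm) : tm :=
  match s with
  | V i => if Nat.eqb i n then u else V i
  | A s t => A (tsubst s n u) (tsubst t n u)
  | L s => L (tsubst s n.+1 u)
  | C v => C v
  end.

Fixpoint tclosed (d : nat) (s : tm) : bool :=
  match s with
  | V n => n < d
  | A s t => tclosed d s && tclosed d t
  | L s => tclosed d.+1 s
  | C _ => true
  end.

Lemma comp_tsubst s n u : tmlam (tsubst s n u) = subst (tmlam s) n (tmlam u).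
Proof.
elim: s n => [i|s IHs t IHt|s IHs|v] n /=.
- by case: PeanoNat.Nat.eqb_spec => [->|/eqP/negPf ->]; rewrite ?eqxx.
- by rewrite IHs IHt.
- by rewrite IHs.
- by rewrite (@closed_at_subst _ 0) // cval_closed.
Qed.

Lemma comp_closed d s : tclosed d s -> closed_at d (tmlam s).
Proof.
elim: s d => [i|s IHs t IHt|s IHs|v] d //=.
- by case/andP=> /IHs -> /IHt ->.
- by move/IHs.
- by rewrite cval_closed.
Qed.

(* Reduction in at most c steps, stated through the values reached: the steps
   made in the two sides of an application then simply add up. *)
Definition red (c : nat) (s s' : tm) : Prop :=
  forall n w, eval n (tmlam s') w -> exists2 n', n' <= n + c & eval n' (tmlam s) w.

Lemma red_eq s s' : tmlam s = tmlam s' -> red 0 s s'.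
Proof. by move=> e n w; rewrite e => ev; exists n => //; rewrite addn0. Qed.

Lemma red_refl s : red 0 s s.
Proof. exact: red_eq. Qed.

Lemma red_le c c' s s' : red c s s' -> c <= c' -> red c' s s'.
Proof.
by move=> h le_c n w /h [n' le_n ev]; exists n' => //; lia.
Qed.

Lemma red_trans c1 c2 s s' w :
  red c1 s s' -> red c2 s' w -> red (c1 + c2) s w.
Proof.
move=> h1 h2 n v /h2 [n2 le2 /h1 [n1 le1 ev]]; exists n1 => //; lia.
Qed.

Lemma eval_appE n s t w : eval n (App s t) w ->
  exists b u i j l, [/\ eval i s (Lam b), eval j t u,
    eval l (Defs.subst b 0 u) w & n = (i + j + l).+1].
Proof.
move=> ev; inversion ev as [|s' t' b u v i j l hs ht hb]; subst.
by exists b, u, i, j, l.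
Qed.

Lemma red_congL c s s' t : red c s s' -> red c (A s t) (A s' t).
Proof.
move=> h n w /eval_appE [b [u [i [j [l [/h[i' le_i hs] ht hb ->]]]]]].
exists (i' + j + l).+1; [lia | exact: eval_app hs ht hb].
Qed.

Lemma red_congR c s t t' : red c t t' -> red c (A s t) (A s t').
Proof.
move=> h n w /eval_appE [b [u [i [j [l [hs /h[j' le_j ht] hb ->]]]]]].
exists (i + j' + l).+1; [lia | exact: eval_app hs ht hb].
Qed.

Lemma red_beta b u : red 1 (A (L b) (C u)) (tsubst b 0 (C u)).
Proof.
move=> n w; rewrite comp_tsubst /=; have [b' ->] := cval_lam u => ev.
by exists (0 + 0 + n).+1; [lia | apply: eval_app (eval_lam _) (eval_lam _) ev].
Qed.

Lemma red_eval c s v :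
  red c s (C v) -> exists2 n, n <= c & eval n (tmlam s) (vl v).
Proof.
have [b e] := cval_lam v; rewrite e => h.
have ev0 : eval 0 (tmlam (C v)) (Lam b) by rewrite /= e; apply: eval_lam.
by have [n le_n ev] := h 0 (Lam b) ev0; exists n.
Qed.

(** A value evaluates only to itself, in 0 steps, so no other continuation has to be considered.
    This turns the running times assumed of the given programs into reductions. *)
Lemma eval_red c n s (v : cval) : eval n (tmlam s) (vl v) -> n <= c -> red c s (C v).
Proof.
move=> ev le_n n' w /=; have [b e] := cval_lam v; rewrite e => ev'.
inversion ev'; subst; exists n; first by lia.
by rewrite -e.
Qed.

(* Named abstraction: an [hterm] is a term as a function of its binding depth,
   and a bound variable computes its de Bruijn index from the depth at which it
   is used. *)
Definition hterm := nat -> tm.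
Definition cst (v : cval) : hterm := fun _ => C v.
Definition ap (s t : hterm) : hterm := fun d => A (s d) (t d).
Definition lm (f : hterm -> hterm) : hterm :=
  fun d => L (f (fun d' => V (Nat.sub d' d.+1)) d.+1).
Coercion cst : cval >-> hterm.

Notation "s · t" := (ap s t) (at level 40, left associativity).
Notation "'fn' x .. y => b" := (lm (fun x => .. (lm (fun y => b)) ..))
  (at level 200, x binder, y binder, right associativity).

Lemma clos_procedure b : tclosed 1 b -> procedure (tmlam (L b)).
Proof. exact: comp_closed. Qed.

Definition clos (b : tm) (H : tclosed 1 b) : cval := CVal (clos_procedure H).

(** Free of cost, since both sides compile to the same lambda term. It turns a closed abstraction
    left by a substitution into a constant, the only kind of argument that [red_beta] accepts. *)
Lemma red_clos s b (H : tclosed 1 b) : red 0 (A s (L b)) (A s (C (clos H))).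
Proof. exact: red_eq. Qed.

Lemma red_clos_beta b H u : red 1 (A (C (@clos b H)) (C u)) (tsubst b 0 (C u)).
Proof. exact: red_beta. Qed.

Definition body (s : hterm) : tm := if s 0 is L b then b else V 0.

Notation prog s := (@clos (body s) erefl).

(** A call-by-value fixed-point combinator. The self-application is eta-expanded to
    [fn y => z · z · y], which is already a value, so that unfolding stops after one round; once z
    is [fix_copy F], this value is [fixv F] itself. *)
Definition fix_body (F : cval) : hterm :=
  fn z x => F · (fn y => z · z · y) · x.
Definition fix_copy (F : cval) : cval := prog (fix_body F).
Definition fixv (F : cval) : cval := prog (fn y => fix_copy F · fix_copy F · y).

Ltac norm := cbn [tsubst Nat.eqb lm ap cst Nat.sub foldl map body].

(* [step_in t] reduces some subterm of the left-hand side, not under a binder,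
   by the reduction that the tactic t proves. *)
Ltac step_in t :=
  first [ t | eapply red_congL; step_in t | eapply red_congR; step_in t ].
Ltac arg_clos :=
  match goal with |- red _ (A ?s (L ?b)) _ => exact (@red_clos s b erefl) end.
Tactic Notation "rw" uconstr(H) :=
  eapply red_trans; [step_in ltac:(eapply H) | norm].
Ltac start := eapply red_le; [norm |].

Lemma red_fix F u :
  red 4 (A (C (fixv F)) (C u)) (A (A (C F) (C (fixv F))) (C u)).
Proof.
start.
  rw red_clos_beta.
  eapply red_trans; [step_in ltac:(eapply red_clos_beta)|norm].
  rw red_beta.
  exact: red_eq.
by [].
Qed.

(** * Scott encodings as closed values, and the cost of case analysis on them *)

Lemma enc_seq_procedure xs : procedure (enc_seq (map vl xs)).
Proof.
elim: xs => //= x xs; case: (enc_seq _) => //= s hs.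
by rewrite cval_closed (closed_at_weak hs).
Qed.

Lemma enc_tuple_procedure xs : procedure (enc_tuple (map vl xs)).
Proof.
rewrite /enc_tuple /apps /=; set h := Var 0.
have: closed_at 1 h by [].
elim: xs h => //= x xs IH h hh; apply: IH => /=.
by rewrite hh cval_closed.
Qed.

Lemma enc_bool_procedure b : procedure (enc_bool b).
Proof. by case: b. Qed.

Lemma enc_nat_procedure n : procedure (enc_nat n).
Proof.
elim: n => //= n; case: (enc_nat n) => //= s hs.
by rewrite (closed_at_weak hs).
Qed.

Definition eseq xs := CVal (enc_seq_procedure xs).
Definition etup xs := CVal (enc_tuple_procedure xs).
Definition ebool b := CVal (enc_bool_procedure b).
Definition enat n := CVal (enc_nat_procedure n).

Arguments eseq : simpl never.
Arguments etup : simpl never.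
Arguments ebool : simpl never.
Arguments enat : simpl never.

Lemma red2 b u v :
  red 2 (A (A (L (L b)) (C u)) (C v)) (tsubst (tsubst b 1 (C u)) 0 (C v)).
Proof.
apply: (@red_trans 1 1); first exact/red_congL/red_beta.
exact: red_beta.
Qed.

Lemma red_conv c s s1 s' : tmlam s = tmlam s1 -> red c s1 s' -> red c s s'.
Proof. by rewrite /red => ->. Qed.

Lemma red_nil u v : red 2 (A (A (C (eseq [::])) (C u)) (C v)) (C u).
Proof.
by apply: (@red_conv _ _ (A (A (L (L (V 1))) (C u)) (C v))) => //; apply: red2.
Qed.

Lemma red_cons x xs u v :
  red 2 (A (A (C (eseq (x :: xs))) (C u)) (C v))
    (A (A (C v) (C x)) (C (eseq xs))).
Proof.
apply: (@red_conv _ _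
  (A (A (L (L (A (A (V 0) (C x)) (C (eseq xs))))) (C u)) (C v))) => //.
exact: red2.
Qed.

Lemma red_zero u v : red 2 (A (A (C (enat 0)) (C u)) (C v)) (C u).
Proof.
by apply: (@red_conv _ _ (A (A (L (L (V 1))) (C u)) (C v))) => //; apply: red2.
Qed.

Lemma red_succ n u v :
  red 2 (A (A (C (enat n.+1)) (C u)) (C v)) (A (C v) (C (enat n))).
Proof.
apply: (@red_conv _ _ (A (A (L (L (A (V 0) (C (enat n))))) (C u)) (C v))) => //.
exact: red2.
Qed.

Lemma red_bool (b : bool) u v :
  red 2 (A (A (C (ebool b)) (C u)) (C v)) (C (if b then u else v)).
Proof.
case: b.
  by apply: (@red_conv _ _ (A (A (L (L (V 1))) (C u)) (C v))) => //; apply: red2.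
by apply: (@red_conv _ _ (A (A (L (L (V 0))) (C u)) (C v))) => //; apply: red2.
Qed.

Lemma red_tuple xs u :
  red 1 (A (C (etup xs)) (C u)) (foldl A (C u) (map C xs)).
Proof.
apply: (@red_conv _ _ (A (L (foldl A (V 0) (map C xs))) (C u))).
  rewrite /= /enc_tuple /apps; congr (App (Lam _) _).
  by elim: xs (V 0) (Var 0) (erefl : Var 0 = tmlam (V 0)) => //= x xs IH h _ ->;
     apply: IH.
have := @red_beta (foldl A (V 0) (map C xs)) u.
suff -> : forall h, tsubst (foldl A h (map C xs)) 0 (C u) =
    foldl A (tsubst h 0 (C u)) (map C xs) by [].
by elim: xs => //= x xs IH h; rewrite IH.
Qed.

Definition nil_v : cval := eseq [::].
Definition true_v : cval := ebool true.
Definition false_v : cval := ebool false.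
Definition cons_v : cval := prog (fn x xs n c => c · x · xs).

Ltac prim :=
  lazymatch goal with
  | |- red _ (A _ (L _)) _ => arg_clos
  | |- red _ (A (L _) (C _)) _ => eapply red_beta
  | |- red _ (A (C (@clos _ _)) (C _)) _ => eapply red_clos_beta
  | |- red _ (A (A (C (eseq [::])) (C _)) (C _)) _ => eapply red_nil
  | |- red _ (A (A (C (eseq (_ :: _))) (C _)) (C _)) _ => eapply red_cons
  | |- red _ (A (A (C (ebool _)) (C _)) (C _)) _ => eapply red_bool
  | |- red _ (A (A (C (enat 0)) (C _)) (C _)) _ => eapply red_zero
  | |- red _ (A (A (C (enat (S _))) (C _)) (C _)) _ => eapply red_succ
  | |- red _ (A (C (etup _)) (C _)) _ => eapply red_tuple
  end.
Ltac go := norm; repeat (eapply red_trans; [step_in ltac:(idtac; prim) | norm]).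

Ltac beta_of f :=
  eapply red_trans;
  [step_in ltac:(idtac; lazymatch goal with
    |- red _ (A (C f) (C _)) _ => eapply red_clos_beta end) | norm].
Ltac unf f := beta_of f; go.
Ltac unfix f F :=
  eapply red_trans;
  [step_in ltac:(idtac; lazymatch goal with
    |- red _ (A (C f) (C _)) _ => eapply red_fix end) | beta_of F; go].

Lemma red_cons_v x xs :
  red 4 (A (A (C cons_v) (C x)) (C (eseq xs))) (C (eseq (x :: xs))).
Proof. by start; [unf cons_v; exact: red_eq | ]. Qed.

(* Costs are measured by powers of a single number B that bounds all the sizes
   at hand, so that constant factors are absorbed by incrementing the exponent. *)
Definition pw (B j : nat) := B ^ j.

Section Costs.
Variable B : nat.
Hypothesis hB : 64 <= B.
Local Notation P := (pw B).

Lemma pw_le i j : i <= j -> P i <= P j.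
Proof. by move=> le_ij; rewrite /pw leq_pexp2l //; lia. Qed.

Lemma pw_step j : 64 * P j <= P j.+1.
Proof. by rewrite /pw expnS leq_mul2r hB orbT. Qed.

Lemma pw_gt0 j : 0 < P j.
Proof. by rewrite /pw expn_gt0; lia. Qed.

Lemma pw_B : B = P 1.
Proof. by rewrite /pw expn1. Qed.

(** A loop costs two exponents: one pays for at most B rounds, the other for the constants. With
    [a + c <= 31 * P j] and [n.+1 <= 2 * B] the product of the constants is 62, hence the choice of
    64 as lower bound of B. *)
Lemma loop_cost n a j c :
  n <= B -> a <= P j -> c <= 30 -> (a + c) * n.+1 <= P j.+2.
Proof.
move=> le_nB le_a le_c.
have h1 := pw_step j; have h2 := pw_gt0 j.
have -> : P j.+2 = P j.+1 * B by rewrite /pw (expnSr _ j.+1).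
apply: leq_trans (_ : (31 * P j) * (2 * B) <= _); last nia.
apply: leq_mul; nia.
Qed.
End Costs.

(** Bounds every power in the sum by the one with exponent J; [pw_step] leaves room for 64 copies of
    it, constants included. *)
Ltac cost :=
  match goal with
  | hB : is_true (64 <= ?B) |- is_true (_ <= pw ?B (S ?J)) =>
     have := pw_step hB J; have := pw_gt0 hB J;
     generalize (pw B (S J)); intro;
     repeat (match goal with
      | |- context [pw B ?i] =>
         tryif constr_eq i J then fail else
         (let h := fresh in
          have h : i <= J by [|lia]; move: (@pw_le B hB i J h) => {h};
          generalize (pw B i); intro)
     end);
     generalize (pw B J); intro; lia
  end.

Definition foldr_body : cval := prog (fn self f z xs =>
  xs · z · (fn x xs' => f · x · (self · f · z · xs'))).
Definition foldr_v : cval := fixv foldr_body.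

(** The step is assumed correct only on accumulators that occur, those folded from a suffix of [xs],
    since only their sizes are under control. *)
Lemma red_foldr X Y (ex : X -> cval) (ey : Y -> cval) (g : X -> Y -> Y) z c f xs :
  (forall p x s, xs = p ++ x :: s ->
     red c (A (A (C f) (C (ex x))) (C (ey (foldr g z s))))
       (C (ey (g x (foldr g z s))))) ->
  red ((c + 20) * (size xs).+1)
    (A (A (A (C foldr_v) (C f)) (C (ey z))) (C (eseq (map ex xs))))
    (C (ey (foldr g z xs))).
Proof.
elim: xs => [|x xs IH] h.
  start.
    unfix foldr_v foldr_body.
    exact: red_refl.
  by lia.
start.
  unfix foldr_v foldr_body.
  rw IH; first by move=> p y s e; apply: (h (x :: p)); rewrite e.
  exact: (h [::]).
by rewrite /=; lia.
Qed.

Lemma red_foldr_le B X Y (ex : X -> cval) (ey : Y -> cval) (g : X -> Y -> Y) z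
    f xs j : 64 <= B -> size xs <= B ->
  (forall p x s, xs = p ++ x :: s ->
     red (pw B j) (A (A (C f) (C (ex x))) (C (ey (foldr g z s))))
       (C (ey (g x (foldr g z s))))) ->
  red (pw B j.+2)
    (A (A (A (C foldr_v) (C f)) (C (ey z))) (C (eseq (map ex xs))))
    (C (ey (foldr g z xs))).
Proof.
move=> hB le_xs h; apply: red_le (red_foldr h) _.
exact: loop_cost.
Qed.

Lemma mem_catcons (X : eqType) (p : seq X) x s xs : xs = p ++ x :: s -> x \in xs.
Proof. by move=> ->; rewrite mem_cat mem_head orbT. Qed.

(** * Programs on lists, numbers and booleans *)

Section Library.
Variables (B : nat) (hB : 64 <= B).
Local Notation P := (pw B).

Definition map_v : cval := prog (fn f xs =>
  foldr_v · (fn x acc => cons_v · (f · x) · acc) · nil_v · xs).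

Lemma red_map (X : eqType) Y (ex : X -> cval) (ey : Y -> cval) (g : X -> Y) f xs j :
  size xs <= B ->
  (forall x, x \in xs -> red (P j.+1) (A (C f) (C (ex x))) (C (ey (g x)))) ->
  red (P j.+4.+1) (A (A (C map_v) (C f)) (C (eseq (map ex xs))))
    (C (eseq (map ey (map g xs)))).
Proof.
move=> le_xs h; start.
  unf map_v.
  rw (@red_foldr_le B _ _ ex (fun ys => eseq (map ey ys))
        (fun x ys => g x :: ys) [::] _ _ j.+2) => //.
  - move=> p x s e; start.
      go.
      rw (h x (mem_catcons e)).
      rw red_cons_v.
      exact: red_refl.
    by cost.
  - exact: red_refl.
by cost.
Qed.
Definition filter_v : cval := prog (fn f xs =>
  foldr_v · (fn x acc => f · x · (cons_v · x · acc) · acc) · nil_v · xs).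

Lemma red_filter (X : eqType) (ex : X -> cval) (g : pred X) f xs j :
  size xs <= B ->
  (forall x, x \in xs ->
     red (P j.+1) (A (C f) (C (ex x))) (C (ebool (g x)))) ->
  red (P j.+4.+1) (A (A (C filter_v) (C f)) (C (eseq (map ex xs))))
    (C (eseq (map ex (filter g xs)))).
Proof.
move=> le_xs h; start.
  unf filter_v.
  rw (@red_foldr_le B _ _ ex (fun ys => eseq (map ex ys))
        (fun x ys => if g x then x :: ys else ys) [::] _ _ j.+2) => //.
  - move=> p x s e; start.
      go.
      rw (h x (mem_catcons e)).
      rw red_cons_v.
      go.
      by case: (g x); exact: red_refl.
    by cost.
  - exact: red_refl.
by cost.
Qed.

Definition cat_v : cval := prog (fn xs ys => foldr_v · cons_v · ys · xs).

Lemma red_cat X (ex : X -> cval) xs ys : size xs <= B ->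
  red (P 4) (A (A (C cat_v) (C (eseq (map ex xs)))) (C (eseq (map ex ys))))
    (C (eseq (map ex (xs ++ ys)))).
Proof.
move=> le_xs; start.
  unf cat_v.
  rw (@red_foldr_le B _ _ ex (fun ys => eseq (map ex ys)) cons ys _ _ 1) => //.
  - move=> p x s e; start.
      rw red_cons_v.
      exact: red_refl.
    by cost.
  - rewrite (_ : foldr cons ys xs = xs ++ ys); first exact: red_refl.
    by elim: (xs) => //= x s ->.
by cost.
Qed.

Definition flatten_v : cval := prog (fn xss => foldr_v · cat_v · nil_v · xss).

Lemma red_flatten (X : eqType) (ex : X -> cval) (xss : seq (seq X)) :
  size xss <= B -> (forall xs, xs \in xss -> size xs <= B) ->
  red (P 7)
    (A (C flatten_v) (C (eseq (map (fun xs => eseq (map ex xs)) xss))))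
    (C (eseq (map ex (flatten xss)))).
Proof.
move=> le_xss le_xs; start.
  unf flatten_v.
  rw (@red_foldr_le B _ _ (fun xs => eseq (map ex xs))
        (fun ys => eseq (map ex ys)) cat [::] _ _ 4) => //.
  - move=> p x s e; start.
      rw red_cat; first exact: le_xs (mem_catcons e).
      exact: red_refl.
    by cost.
  - exact: red_refl.
by cost.
Qed.

Definition has_v : cval := prog (fn f xs =>
  foldr_v · (fn x acc => f · x · true_v · acc) · false_v · xs).

Lemma red_has (X : eqType) (ex : X -> cval) (g : pred X) f xs j :
  size xs <= B ->
  (forall x, x \in xs ->
     red (P j.+1) (A (C f) (C (ex x))) (C (ebool (g x)))) ->
  red (P j.+4.+1) (A (A (C has_v) (C f)) (C (eseq (map ex xs))))
    (C (ebool (has g xs))).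
Proof.
move=> le_xs h; start.
  unf has_v.
  rw (@red_foldr_le B _ _ ex ebool (fun x b => g x || b) false _ _ j.+2) => //.
  - move=> p x s e; start.
      go.
      rw (h x (mem_catcons e)).
      go.
      by case: (g x); exact: red_refl.
    by cost.
  - exact: red_refl.
by cost.
Qed.

Definition all_v : cval := prog (fn f xs =>
  foldr_v · (fn x acc => f · x · acc · false_v) · true_v · xs).

Lemma red_all (X : eqType) (ex : X -> cval) (g : pred X) f xs j :
  size xs <= B ->
  (forall x, x \in xs ->
     red (P j.+1) (A (C f) (C (ex x))) (C (ebool (g x)))) ->
  red (P j.+4.+1) (A (A (C all_v) (C f)) (C (eseq (map ex xs))))
    (C (ebool (all g xs))).
Proof.
move=> le_xs h; start.
  unf all_v.
  rw (@red_foldr_le B _ _ ex ebool (fun x b => g x && b) true _ _ j.+2) => //.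
  - move=> p x s e; start.
      go.
      rw (h x (mem_catcons e)).
      go.
      by case: (g x); exact: red_refl.
    by cost.
  - exact: red_refl.
by cost.
Qed.

Definition eqseq_body : cval := prog (fn self eq xs ys =>
  xs · (ys · true_v · (fn y ys' => false_v))
     · (fn x xs' => ys · false_v
          · (fn y ys' => eq · x · y · (self · eq · xs' · ys') · false_v))).
Definition eqseq_v : cval := fixv eqseq_body.

(** Call by value evaluates the recursive call even when the heads differ, so the elements are
    compared up to the end of the shorter list. The cost is still one round per element of [xs]. *)
Lemma red_eqseq (X : eqType) (ex : X -> cval) f xs ys j :
  size xs <= B ->
  (forall x y, x \in xs -> y \in ys ->
     red (P j) (A (A (C f) (C (ex x))) (C (ex y))) (C (ebool (x == y)))) ->
  red (P j.+2)
    (A (A (A (C eqseq_v) (C f)) (C (eseq (map ex xs)))) (C (eseq (map ex ys))))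
    (C (ebool (xs == ys))).
Proof.
move=> le_xs h; apply: (@red_le ((P j + 30) * (size xs).+1)); last first.
  exact: loop_cost.
elim: xs ys {le_xs} h => [|x xs IH] [|y ys] h.
- start.
    unfix eqseq_v eqseq_body.
    exact: red_refl.
  by lia.
- start.
    unfix eqseq_v eqseq_body.
    exact: red_refl.
  by lia.
- start.
    unfix eqseq_v eqseq_body.
    exact: red_refl.
  by rewrite /=; lia.
- start.
    unfix eqseq_v eqseq_body.
    rw (IH ys).
      by move=> x' y' hx' hy'; apply: h; rewrite in_cons ?hx' ?hy' orbT.
    rw (h x y); [exact: mem_head | exact: mem_head |].
    go.
    by rewrite eqseq_cons; case: (x == y); exact: red_refl.
  by rewrite /=; lia.
Qed.

Definition eqnat_body : cval := prog (fn self m n =>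
  m · (n · true_v · (fn n' => false_v))
    · (fn m' => n · false_v · (fn n' => self · m' · n'))).
Definition eqnat_v : cval := fixv eqnat_body.

Lemma red_eqnat m n : m <= B ->
  red (P 3) (A (A (C eqnat_v) (C (enat m))) (C (enat n))) (C (ebool (m == n))).
Proof.
move=> le_m; apply: (@red_le ((P 1 + 30) * m.+1)); last exact: loop_cost.
elim: m n {le_m} => [|m IH] [|n].
- start.
    unfix eqnat_v eqnat_body.
    exact: red_refl.
  by lia.
- start.
    unfix eqnat_v eqnat_body.
    exact: red_refl.
  by lia.
- start.
    unfix eqnat_v eqnat_body.
    exact: red_refl.
  by lia.
- start.
    unfix eqnat_v eqnat_body.
    rw (IH n).
    by rewrite eqSS; exact: red_refl.
  by lia.
Qed.

Definition eqbool_v : cval := prog (fn a b => a · b · (b · false_v · true_v)).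

Lemma red_eqbool (a b : bool) :
  red (P 1) (A (A (C eqbool_v) (C (ebool a))) (C (ebool b))) (C (ebool (a == b))).
Proof.
start.
  unf eqbool_v.
  by case: a; case: b; exact: red_refl.
by cost.
Qed.

Definition mem_v : cval := prog (fn eq x xs => has_v · (fn y => eq · x · y) · xs).

Lemma red_mem (X : eqType) (ex : X -> cval) f x xs j : size xs <= B ->
  (forall y, y \in xs ->
    red (P j) (A (A (C f) (C (ex x))) (C (ex y))) (C (ebool (x == y)))) ->
  red (P j.+4.+2) (A (A (A (C mem_v) (C f)) (C (ex x))) (C (eseq (map ex xs))))
    (C (ebool (x \in xs))).
Proof.
move=> le_xs h; start.
  unf mem_v.
  rw (@red_has _ ex (eq_op x) _ xs j le_xs).
    move=> y hy; start.
      go.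
      rw (h y hy).
      exact: red_refl.
    by cost.
  rewrite (_ : has (eq_op x) xs = (x \in xs)); first exact: red_refl.
  by rewrite -has_pred1; apply: eq_has => y; rewrite /= eq_sym.
by cost.
Qed.

Definition undup_v : cval := prog (fn eq xs =>
  foldr_v · (fn x acc => mem_v · eq · x · acc · acc · (cons_v · x · acc))
    · nil_v · xs).

Lemma red_undup (X : eqType) (ex : X -> cval) f xs j : size xs <= B ->
  (forall x y, x \in xs -> y \in xs ->
    red (P j) (A (A (C f) (C (ex x))) (C (ex y))) (C (ebool (x == y)))) ->
  red (P j.+4.+4.+2) (A (A (C undup_v) (C f)) (C (eseq (map ex xs))))
    (C (eseq (map ex (undup xs)))).
Proof.
move=> le_xs h; start.
  unf undup_v.
  rw (@red_foldr_le B _ _ ex (fun ys => eseq (map ex ys))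
        (fun x ys => if x \in ys then ys else x :: ys) [::] _ _ j.+4.+3) => //.
  - move=> p x s e; have suf y : y \in undup s -> y \in xs.
      by rewrite mem_undup => hy; rewrite e mem_cat in_cons hy !orbT.
    have -> : foldr (fun x ys => if x \in ys then ys else x :: ys) [::] s = undup s.
      by elim: s {e suf} => //= y s ->; rewrite mem_undup.
    start.
      go.
      rw (@red_mem _ ex _ _ (undup s) j).
      + rewrite (leq_trans (size_undup _)) //.
        by rewrite e size_cat /= in le_xs; lia.
      + by move=> y /suf; apply: h; exact: mem_catcons e.
      rw red_cons_v.
      go.
      by case: (x \in undup s); exact: red_refl.
    by cost.
  - rewrite (_ : foldr _ _ _ = undup xs); first exact: red_refl.
    by elim: (xs) => //= y s ->; rewrite mem_undup.
by cost.
Qed.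

Definition prodl (T : Type) : seq (seq T) -> seq (seq T) :=
  foldr (fun xs acc => flatten [seq [seq w :: ws | ws <- acc] | w <- xs])
    [:: [::]].

Definition prod_v : cval := prog (fn xss =>
  foldr_v · (fn xs acc =>
      flatten_v · (map_v · (fn w => map_v · (fn ws => cons_v · w · ws) · acc) · xs))
    · (cons_v · nil_v · nil_v) · xss).

(** The accumulators are the products of the suffixes. Bounding the whole product would not suffice:
    an empty first factor makes it empty whatever the size of the others. *)
Lemma red_prod (X : eqType) (ex : X -> cval) (xss : seq (seq X)) :
  size xss <= B -> (forall xs, xs \in xss -> size xs <= B) ->
  (forall p s, xss = p ++ s -> size (prodl s) <= B) ->
  red (P 14) (A (C prod_v) (C (eseq (map (fun xs => eseq (map ex xs)) xss))))
    (C (eseq (map (fun xs => eseq (map ex xs)) (prodl xss)))).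
Proof.
move=> le_xss le_xs le_p; start.
  unf prod_v.
  rw (@red_cons_v (eseq [::]) [::]).
  rw (@red_foldr_le B _ _ (fun xs => eseq (map ex xs))
        (fun yss => eseq (map (fun xs => eseq (map ex xs)) yss))
        (fun xs acc => flatten [seq [seq w :: ws | ws <- acc] | w <- xs])
        [:: [::]] _ _ 11) => //.
  - move=> p xs s e; rewrite -/(prodl s).
    have le_s : size (prodl s) <= B.
      by apply: (le_p (rcons p xs)); rewrite -cats1 -catA.
    start.
      go.
      rw (@red_map _ _ ex (fun yss => eseq (map (fun xs => eseq (map ex xs)) yss))
            (fun w => [seq w :: ws | ws <- prodl s]) _ xs 5).
      + exact: le_xs (mem_catcons e).
      + move=> w _; start.
          go.
          rw (@red_map _ _ (fun xs => eseq (map ex xs)) (fun xs => eseq (map ex xs))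
                (fun ws => w :: ws) _ (prodl s) 0 le_s).
            move=> ws _; start.
              go.
              rw red_cons_v.
              exact: red_refl.
            by cost.
          exact: red_refl.
        by cost.
      rw (@red_flatten _ (fun xs => eseq (map ex xs))
            [seq [seq w :: ws | ws <- prodl s] | w <- xs]).
      + by rewrite size_map; apply: le_xs (mem_catcons e).
      + by move=> _ /mapP[w _ ->]; rewrite size_map.
      exact: red_refl.
    by cost.
  - exact: red_refl.
by cost.
Qed.

Definition map2_body : cval := prog (fn self f xs ys =>
  xs · nil_v · (fn x xs' => ys · nil_v
    · (fn y ys' => cons_v · (f · x · y) · (self · f · xs' · ys')))).
Definition map2_v : cval := fixv map2_body.

Lemma red_map2 (I : eqType) (ex ey ez : I -> cval) f (s : seq I) j :
  size s <= B ->
  (forall i, i \in s ->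
     red (P j) (A (A (C f) (C (ex i))) (C (ey i))) (C (ez i))) ->
  red (P j.+2)
    (A (A (A (C map2_v) (C f)) (C (eseq (map ex s)))) (C (eseq (map ey s))))
    (C (eseq (map ez s))).
Proof.
move=> le_s h; apply: (@red_le ((P j + 30) * (size s).+1)); last first.
  exact: loop_cost.
elim: s {le_s} h => [|i s IH] h.
  start.
    unfix map2_v map2_body.
    exact: red_refl.
  by lia.
start.
  unfix map2_v map2_body.
  rw IH; first by move=> i' hi; apply: h; rewrite in_cons hi orbT.
  rw (h i (mem_head _ _)).
  rw red_cons_v.
  exact: red_refl.
by rewrite /=; lia.
Qed.
End Library.

(** * The saturation algorithm *)

Lemma mem_prodl (T : eqType) (xss : seq (seq T)) ws :
  (ws \in prodl xss) = all2 (fun w xs => w \in xs) ws xss.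
Proof.
elim: xss ws => [|xs xss IH] [|w ws] //=.
  by apply/negbTE/negP => /allpairsP[[x y]] [].
apply/allpairsP/andP => [[[x ys] /= [hx hys [-> ->]]]|[hw hws]].
  by rewrite -IH.
by exists (w, ws); rewrite /= IH.
Qed.

Lemma prodl_elt (T : eqType) (xss : seq (seq T)) ws w :
  ws \in prodl xss -> w \in ws -> exists2 xs, xs \in xss & w \in xs.
Proof.
rewrite mem_prodl; elim: xss ws => [|xs xss IH] [|v ws] //= /andP[hv hws].
rewrite in_cons => /predU1P[->|hw]; first by exists xs; rewrite ?mem_head.
by have [ys hys hw'] := IH ws hws hw; exists ys => //; rewrite in_cons hys orbT.
Qed.

Lemma size_prodl_le (T : eqType) (xss : seq (seq T)) N :
  (forall xs, xs \in xss -> size xs <= N) -> size (prodl xss) <= N ^ size xss.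
Proof.
elim: xss => //= xs xss IH h; rewrite size_allpairs expnS leq_mul //.
  by apply: h; rewrite mem_head.
by apply: IH => ys hys; apply: h; rewrite in_cons hys orbT.
Qed.

Lemma size_flatten_le (T : eqType) (xss : seq (seq T)) N :
  (forall xs, xs \in xss -> size xs <= N) -> size (flatten xss) <= size xss * N.
Proof.
elim: xss => //= xs xss IH h; rewrite size_cat mulSn leq_add //.
  by apply: h; rewrite mem_head.
by apply: IH => ys hys; apply: h; rewrite in_cons hys orbT.
Qed.

(** * Encodings of the data and the programs of the saturation algorithm *)

Definition eword (w : word) : cval := eseq (map ebool w).
Definition ewords (ws : seq word) : cval := eseq (map eword ws).
Definition esymb (a : symbol) : cval := etup [:: eword a.1; enat a.2].
Definition erule (rho : ta_rule) : cval :=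
  etup [:: esymb rho.1.1; eseq (map enat rho.1.2); enat rho.2].
Definition eaut (A : tree_automaton) : cval :=
  etup [:: enat (nstates A); eseq (map enat (final_states A));
           eseq (map erule (rules A))].

Lemma vl_eword w : vl (eword w) = enc_word w.
Proof. by rewrite /= -map_comp. Qed.

Lemma vl_ewords ws : vl (ewords ws) = enc_words ws.
Proof. by rewrite /= -map_comp; congr enc_seq; apply: eq_map => w; apply: vl_eword. Qed.

Lemma vl_esymb a : vl (esymb a) = enc_symbol a.
Proof. by rewrite /= -map_comp. Qed.

Lemma vl_erule rho : vl (erule rho) = enc_rule rho.
Proof. by rewrite /= -!map_comp. Qed.

Lemma vl_eaut A : vl (eaut A) = enc_automaton A.
Proof.
rewrite /= -!map_comp; congr (enc_tuple [:: _; _; enc_seq _]).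
by apply: eq_map => rho; apply: vl_erule.
Qed.

Definition eqword_v : cval := prog (fn v w => eqseq_v · eqbool_v · v · w).
Definition eqwords_v : cval := prog (fn v w => eqseq_v · eqword_v · v · w).
Definition eqtuple_v : cval := prog (fn v w => eqseq_v · eqwords_v · v · w).
Definition eqent_v : cval := prog (fn e1 e2 =>
  e1 · (fn q1 T1 => e2 · (fn q2 T2 =>
    eqnat_v · q1 · q2 · (eqtuple_v · T1 · T2) · false_v))).

Definition pair_v : cval := prog (fn x y s => s · x · y).
Definition snd_v : cval := prog (fn e => e · (fn x y => y)).

(* [Ss] is empty for a symbol of arity 0; the two cases are delayed by an
   abstraction, because p_leaf and p_trans may diverge outside of their case. *)
Definition step_v : cval := prog (fn k a C Ss =>
  C · (fn w l t f c i => Ss · (fn d => l · k · a)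
    · (fn S Ss' d => c · k · (undup_v · eqword_v
         · (flatten_v · (map_v · (fn ws => t · k · a · ws) · (prod_v · Ss)))))
    · nil_v)).

(** Transposition, from one tuple per child to one list of sets per core. The fold starts with an
    empty list for each core, so that a leaf, without children, still yields an argument for every
    core. *)
Definition transp_v : cval := prog (fn cores Ts =>
  foldr_v · (fn T acc => map2_v · cons_v · T · acc)
    · (map_v · (fn C => nil_v) · cores) · Ts).

Definition newtuple_v : cval := prog (fn k a cores Ts =>
  map2_v · (fn C Ss => step_v · k · a · C · Ss) · cores · (transp_v · cores · Ts)).

Definition cand_v : cval := prog (fn k cores R rule => rule · (fn a qs q =>
  map_v · (fn es => pair_v · q · (newtuple_v · k · a · cores · (map_v · snd_v · es)))
    · (prod_v · (map_v
         · (fn q' => filter_v · (fn e => e · (fn q1 T => eqnat_v · q1 · q')) · R)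
         · qs)))).

Definition fresh_v : cval := prog (fn k cores rules R =>
  filter_v · (fn e => mem_v · eqent_v · e · R · false_v · true_v)
    · (flatten_v · (map_v · (fn rule => cand_v · k · cores · R · rule) · rules))).

(** A round adds a single fresh entry and drops the other candidates, which the next round computes
    again. This costs a polynomial factor but keeps the list duplicate-free although the candidates
    may repeat. *)
Definition loop_body : cval := prog (fn self new R =>
  new · R · R · (fn e es => self · new · (cons_v · e · R))).
Definition loop_v : cval := fixv loop_body.

Definition check_v : cval := prog (fn k cores pc finals e => e · (fn q T =>
  has_v · (fn q' => eqnat_v · q · q') · finals
    · (pc · (map2_v · (fn C S => C · (fn w l t f c i =>
                        has_v · (fn w => f · k · w) · S)) · cores · T)
          · (map2_v · (fn C S => C · (fn w l t f c i => i · k · S)) · cores · T))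
    · true_v)).

Definition decide_v : cval := prog (fn pA cores pc k =>
  pA · k · (fn n finals rules =>
    all_v · (fn e => check_v · k · cores · pc · finals · e)
      · (loop_v · (fn R => fresh_v · k · cores · rules · R) · nil_v))).

(** * Cost of the saturation programs, for core programs given by their runs *)

Section Run.
Variables (B : nat) (hB : 64 <= B).
Local Notation P := (pw B).

Lemma red_eqword v w : size v <= B ->
  red (P 4) (A (A (C eqword_v) (C (eword v))) (C (eword w))) (C (ebool (v == w))).
Proof.
move=> le_v; start.
  unf eqword_v.
  rw (@red_eqseq B hB _ ebool _ v w 1 le_v).
    by move=> a b _ _; exact: red_eqbool.
  exact: red_refl.
by cost.
Qed.

Definition small (ws : seq word) : Prop :=
  size ws <= B /\ forall w, w \in ws -> size w <= B.

Lemma red_eqwords vs ws : small vs ->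
  red (P 7) (A (A (C eqwords_v) (C (ewords vs))) (C (ewords ws)))
    (C (ebool (vs == ws))).
Proof.
move=> [le_v h]; start.
  unf eqwords_v.
  rw (@red_eqseq B hB _ eword _ vs ws 4 le_v).
    by move=> a b ha _; apply/red_eqword/h.
  exact: red_refl.
by cost.
Qed.

Lemma red_pair x y : red 4 (A (A (C pair_v) (C x)) (C y)) (C (etup [:: x; y])).
Proof. by start; [unf pair_v; exact: red_eq|]. Qed.

Section Cores.
Variables (m : nat).
Definition entry : eqType := (nat * {ffun 'I_m -> seq word})%type.
Definition etuple (T : {ffun 'I_m -> seq word}) : cval :=
  eseq [seq ewords (T i) | i <- enum 'I_m].
Definition eent (e : entry) : cval := etup [:: enat e.1; etuple e.2].
Definition small_entry (e : entry) : Prop := e.1 <= B /\ forall i, small (e.2 i).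

Hypothesis le_m : m <= B.

Lemma size_enum_m : size (enum 'I_m) <= B.
Proof. by rewrite size_enum_ord. Qed.

Lemma red_eqtuple (T1 T2 : {ffun 'I_m -> seq word}) : (forall i, small (T1 i)) ->
  red (P 10) (A (A (C eqtuple_v) (C (etuple T1))) (C (etuple T2)))
    (C (ebool (T1 == T2))).
Proof.
move=> h; start.
  unf eqtuple_v.
  rewrite /etuple (map_comp ewords T1) (map_comp ewords T2).
  rw (@red_eqseq B hB _ ewords _ (map T1 (enum 'I_m)) (map T2 (enum 'I_m)) 7).
  - by rewrite size_map size_enum_m.
  - by move=> _ ws /mapP[i _ ->] _; exact: red_eqwords.
  rewrite (_ : (_ == _) = (T1 == T2)); first exact: red_refl.
  apply/eqP/eqP => [/eq_in_map e|-> //].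
  by apply/ffunP => i; apply: e; rewrite mem_enum.
by cost.
Qed.

Lemma red_eqent e1 e2 : small_entry e1 ->
  red (P 11) (A (A (C eqent_v) (C (eent e1))) (C (eent e2)))
    (C (ebool (e1 == e2))).
Proof.
case: e1 e2 => q1 T1 [q2 T2] [/= hq hT]; rewrite /eent /=; start.
  unf eqent_v.
  rw (@red_eqnat B hB q1 q2 hq).
  rw (@red_eqtuple T1 T2 hT).
  go.
  by rewrite xpair_eqE; case: (q1 == q2); exact: red_refl.
by cost.
Qed.

Variables (wv lv tv fv cv nv : 'I_m -> cval) (k : nat).
(** Stand for the lists that the core programs actually output, in their own order; the sets alone
    do not determine a run. *)
Variables (leafF : 'I_m -> symbol -> seq word).
Variables (trF : 'I_m -> symbol -> seq word -> seq word).
Variables (clF : 'I_m -> seq word -> seq word).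

Definition ecore (i : 'I_m) : cval :=
  etup [:: wv i; lv i; tv i; fv i; cv i; nv i].
Definition ecores : cval := eseq [seq ecore i | i <- enum 'I_m].

Definition unionF i a (Ss : seq (seq word)) : seq word :=
  undup (flatten [seq trF i a ws | ws <- prodl Ss]).
Definition stepF i a (Ss : seq (seq word)) : seq word :=
  if Ss is [::] then leafF i a else clF i (unionF i a Ss).

Definition leaf_runs i a :=
  red (P 1) (A (A (C (lv i)) (C (enat k))) (C (esymb a))) (C (ewords (leafF i a))).
Definition trans_runs i a ws :=
  red (P 1) (A (A (A (C (tv i)) (C (enat k))) (C (esymb a))) (C (ewords ws)))
    (C (ewords (trF i a ws))).
Definition clean_runs i ws :=
  red (P 1) (A (A (C (cv i)) (C (enat k))) (C (ewords ws))) (C (ewords (clF i ws))).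

(** Runs are demanded only on the choices that arise, because the core programs may diverge on words
    that are not witnesses. The concatenation is bounded before [undup], as the removal of
    duplicates has to traverse it. *)
Definition step_runs i a Ss : Prop :=
  if Ss is [::] then leaf_runs i a else
  [/\ forall p s, Ss = p ++ s -> size (prodl s) <= B,
      forall ws, ws \in prodl Ss -> trans_runs i a ws /\ small (trF i a ws),
      size (flatten [seq trF i a ws | ws <- prodl Ss]) <= B &
      clean_runs i (unionF i a Ss)].

Lemma red_step i a Ss : step_runs i a Ss -> size Ss <= B ->
  (forall S, S \in Ss -> size S <= B) ->
  red (P 15)
    (A (A (A (A (C step_v) (C (enat k))) (C (esymb a))) (C (ecore i)))
       (C (eseq (map ewords Ss))))
    (C (ewords (stepF i a Ss))).
Proof.
case: Ss => [|S Ss].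
  rewrite /= => hl _ _; start.
    unf step_v; rewrite /ecore; go.
    rw hl.
    exact: red_refl.
  by cost.
rewrite /=; set Ss' := S :: Ss => -[hp ht hf hc] le_Ss le_S; start.
  unf step_v; rewrite /ecore; go.
  rw (@red_prod B hB _ eword Ss' le_Ss le_S hp).
  rw (@red_map B hB _ _ ewords ewords (trF i a) _ (prodl Ss') 1).
  - exact: (hp [::]).
  - move=> ws hws; have [tr _] := ht _ hws; start.
      go.
      rw tr.
      exact: red_refl.
    by cost.
  rw (@red_flatten B hB _ eword [seq trF i a ws | ws <- prodl Ss']).
  - by rewrite size_map (hp [::]).
  - by move=> _ /mapP[ws hws ->]; have [_ []] := ht _ hws.
  rw (@red_undup B hB _ eword _ (flatten [seq trF i a ws | ws <- prodl Ss']) 4 hf).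
    move=> v w /flattenP[_ /mapP[ws hws ->]] hv _; apply: red_eqword.
    by have [_ [_]] := ht _ hws; apply.
  rw hc.
  exact: red_refl.
by cost.
Qed.

Definition comps (Ts : seq {ffun 'I_m -> seq word}) (i : 'I_m) : seq (seq word) :=
  [seq (T : {ffun 'I_m -> seq word}) i | T <- Ts].

Lemma red_transp Ts : size Ts <= B ->
  red (P 7) (A (A (C transp_v) (C ecores)) (C (eseq (map etuple Ts))))
    (C (eseq [seq eseq (map ewords (comps Ts i)) | i <- enum 'I_m])).
Proof.
move=> le_Ts; start.
  unf transp_v.
  rw (@red_map B hB _ _ ecore ewords (fun=> [::]) _ _ 0 size_enum_m).
    move=> i _; start.
      go.
      exact: red_refl.
    by cost.
  rewrite -map_comp.
  rw (@red_foldr_le B _ _ etuple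
       (fun F : 'I_m -> seq (seq word) =>
          eseq [seq eseq (map ewords (F i)) | i <- enum 'I_m])
       (fun T F i => T i :: F i) (fun=> [::]) _ Ts 4 hB le_Ts).
    move=> p T s _; set F := foldr _ _ s; start.
      go.
      rw (@red_map2 B hB _ (fun i => ewords (T i))
           (fun i => eseq (map ewords (F i)))
           (fun i => eseq (map ewords (T i :: F i))) _ _ 1 size_enum_m).
        move=> i _; start.
          rw red_cons_v.
          exact: red_refl.
        by cost.
      exact: red_refl.
    by cost.
  set F := foldr _ _ _; rewrite (_ : F = comps Ts); first exact: red_refl.
  by apply/funext => i; rewrite /F; elim: (Ts) => //= T s ->.
by cost.
Qed.

Definition newtuple a (Ts : seq {ffun 'I_m -> seq word}) : {ffun 'I_m -> seq word} :=
  [ffun i => stepF i a (comps Ts i)].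

Lemma red_newtuple a Ts : size Ts <= B ->
  (forall i, step_runs i a (comps Ts i)) ->
  (forall T i, T \in Ts -> small (T i)) ->
  red (P 19)
    (A (A (A (A (C newtuple_v) (C (enat k))) (C (esymb a))) (C ecores))
       (C (eseq (map etuple Ts))))
    (C (etuple (newtuple a Ts))).
Proof.
move=> le_Ts hr hs; start.
  unf newtuple_v.
  rw (@red_transp Ts le_Ts).
  rw (@red_map2 B hB _ ecore (fun i => eseq (map ewords (comps Ts i)))
       (fun i => ewords (stepF i a (comps Ts i))) _ _ 16 size_enum_m).
    move=> i _; start.
      go.
      rw (@red_step i a (comps Ts i) (hr i)).
      - by rewrite size_map.
      - by move=> _ /mapP[T hT ->]; have [] := hs T i hT.
      exact: red_refl.
    by cost.
  rewrite (_ : eseq _ = etuple (newtuple a Ts)); first exact: red_refl.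
  by congr eseq; apply: eq_map => i; rewrite ffunE.
by cost.
Qed.

Definition pools (R : seq entry) (qs : seq nat) : seq (seq entry) :=
  [seq [seq e <- R | e.1 == q] | q <- qs].
Definition cands (R : seq entry) (rho : ta_rule) : seq entry :=
  [seq (rho.2, newtuple rho.1.1 [seq e.2 | e <- es])
     | es <- prodl (pools R rho.1.2)].

Definition cands_run R (rho : ta_rule) : Prop :=
  [/\ size rho.1.2 <= B,
      forall p s, pools R rho.1.2 = p ++ s -> size (prodl s) <= B &
      forall es, es \in prodl (pools R rho.1.2) ->
        forall i, step_runs i rho.1.1 (comps [seq e.2 | e <- es] i)].

Lemma prodl_pools R qs es : es \in prodl (pools R qs) ->
  size es = size qs /\ {subset es <= R}.
Proof.
rewrite mem_prodl; elim: es qs => [|e es IH] [|q qs] //= /andP[].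
rewrite mem_filter => /andP[_ he] /IH[-> hes]; split=> // e'.
by rewrite in_cons => /predU1P[->|/hes].
Qed.

Lemma red_cand R rho : size R <= B -> (forall e, e \in R -> small_entry e) ->
  cands_run R rho ->
  red (P 25)
    (A (A (A (A (C cand_v) (C (enat k))) (C ecores)) (C (eseq (map eent R))))
       (C (erule rho)))
    (C (eseq (map eent (cands R rho)))).
Proof.
case: rho => -[a qs] q le_R hR [/= le_qs hp hs]; rewrite /erule /=; start.
  unf cand_v.
  rw (@red_map B hB _ _ enat (fun es => eseq (map eent es))
        (fun q' => [seq e <- R | e.1 == q']) _ qs 8 le_qs).
    move=> q' _; start.
      go.
      rw (@red_filter B hB _ eent (fun e => e.1 == q') _ R 3 le_R).
        move=> e he; start.
          rewrite /eent; go.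
          rw (@red_eqnat B hB e.1 q'); first by have [] := hR e he.
          exact: red_refl.
        by cost.
      exact: red_refl.
    by cost.
  rewrite -/(pools R qs).
  rw (@red_prod B hB _ eent (pools R qs)).
  - by rewrite size_map.
  - move=> _ /mapP[q' _ ->]; rewrite size_filter.
    exact: leq_trans (count_size _ _) le_R.
  - exact: hp.
  rw (@red_map B hB _ _ (fun es => eseq (map eent es)) eent
        (fun es => (q, newtuple a [seq e.2 | e <- es])) _
        (prodl (pools R qs)) 19).
  - exact: (hp [::]).
  - move=> es hes; have [sz_es sub_es] := prodl_pools hes; start.
      go.
      rw (@red_map B hB _ _ eent etuple (fun e => e.2) _ es 0).
      + by rewrite sz_es.
      + move=> e _; start.
          rewrite /eent; unf snd_v.
          exact: red_refl.
        by cost.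
      rw (@red_newtuple a [seq e.2 | e <- es]).
      + by rewrite size_map sz_es.
      + exact: hs.
      + by move=> _ i /mapP[e /sub_es /hR[_ he] ->]; apply: he.
      rw red_pair.
      exact: red_refl.
    by cost.
  exact: red_refl.
by cost.
Qed.

Variables (rhos : seq ta_rule).

Definition fresh (R : seq entry) : seq entry :=
  [seq e <- flatten [seq cands R rho | rho <- rhos] | e \notin R].

Definition fresh_runs R : Prop :=
  [/\ size R <= B, forall e, e \in R -> small_entry e,
      forall rho, rho \in rhos -> cands_run R rho,
      size (flatten [seq cands R rho | rho <- rhos]) <= B &
      forall rho e, rho \in rhos -> e \in cands R rho -> small_entry e].

Lemma red_fresh R : size rhos <= B -> fresh_runs R ->
  red (P 31)
    (A (A (A (A (C fresh_v) (C (enat k))) (C ecores)) (C (eseq (map erule rhos))))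
       (C (eseq (map eent R))))
    (C (eseq (map eent (fresh R)))).
Proof.
move=> le_rhos [le_R hR hc le_f hcs]; start.
  unf fresh_v.
  rw (@red_map B hB _ _ erule (fun es => eseq (map eent es)) (cands R) _ rhos 25
       le_rhos).
    move=> rho hrho; start.
      go.
      rw (@red_cand R rho le_R hR (hc rho hrho)).
      exact: red_refl.
    by cost.
  rw (@red_flatten B hB _ eent [seq cands R rho | rho <- rhos]).
  - by rewrite size_map.
  - move=> _ /mapP[rho hrho ->]; have [_ /(_ [::]) hp _] := hc rho hrho.
    by rewrite size_map; apply: hp.
  rw (@red_filter B hB _ eent (fun e => e \notin R) _
       (flatten [seq cands R rho | rho <- rhos]) 17 le_f).
    move=> e /flattenP[_ /mapP[rho hrho ->] he]; start.
      go.
      rw (@red_mem B hB _ eent _ e R 11 le_R).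
        by move=> e' _; apply/red_eqent/hcs/he.
      go.
      by case: (e \in R); exact: red_refl.
    by cost.
  exact: red_refl.
by cost.
Qed.

Section Loop.
Variables (E : pred entry).
Hypothesis le_rhos : size rhos <= B.
Hypothesis fresh_ok : forall R, uniq R -> all E R -> fresh_runs R.
Hypothesis fresh_E : forall R, uniq R -> all E R -> all E (fresh R).

(** The functional argument that [decide_v] passes to [loop_v] once its own data have been
    substituted. *)
Definition fresh_clos : cval := clos (erefl : tclosed 1
  (A (A (A (A (C fresh_v) (C (enat k))) (C ecores)) (C (eseq (map erule rhos))))
     (V 0))).

(** Termination: a duplicate-free list of entries satisfying E has at most B elements by [fresh_ok],
    so that [B - size R] decreases whenever an entry is added. *)
Lemma red_loop_from n R : B - size R <= n -> uniq R -> all E R ->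
  exists R', [/\ uniq R', all E R', fresh R' = [::] &
    red ((P 31 + 30) * n.+1)
      (A (A (C loop_v) (C fresh_clos)) (C (eseq (map eent R))))
      (C (eseq (map eent R')))].
Proof.
elim: n R => [|n IH] R le_n uR aR; have hr := red_fresh le_rhos (fresh_ok uR aR);
  have aF := fresh_E uR aR; have uF e : e \in fresh R -> e \notin R
    by rewrite mem_filter => /andP[].
(* With no round left, R already has at least B elements; a fresh entry would give an admissible
   list with more than B elements. *)
- case def_F: (fresh R) aF uF hr => [|e es] /= aF uF hr; last first.
    have uR' : uniq (e :: R) by rewrite /= uR uF ?mem_head.
    have aR' : all E (e :: R) by rewrite /= aR; case/andP: aF => ->.
    have [/= le_R' _ _ _ _] := fresh_ok uR' aR'.
    rewrite leqn0 subn_eq0 in le_n.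
    by have := leq_trans le_R' le_n; rewrite ltnn.
  exists R; split=> //; start.
    unfix loop_v loop_body; rewrite /fresh_clos; go.
    rw hr.
    go.
    exact: red_refl.
  by lia.
case def_F: (fresh R) aF uF hr => [|e es] /= aF uF hr.
  exists R; split=> //; start.
    unfix loop_v loop_body; rewrite /fresh_clos; go.
    rw hr.
    go.
    exact: red_refl.
  by lia.
have uR' : uniq (e :: R) by rewrite /= uR uF ?mem_head.
have aR' : all E (e :: R) by rewrite /= aR; case/andP: aF => ->.
have le_n' : B - size (e :: R) <= n by rewrite /= subnS; case: (B - size R) le_n.
have [R' [uR'' aR'' fR' hR']] := IH _ le_n' uR' aR'.
exists R'; split=> //; start.
  unfix loop_v loop_body; rewrite /fresh_clos; go.
  rw hr.
  go.
  rw red_cons_v.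
  rw hR'.
  exact: red_refl.
by lia.
Qed.
End Loop.

Variables (pc : cval) (finals : seq nat).
Variables (finF : 'I_m -> pred word) (invF : 'I_m -> seq word -> word).
Variable cF : {ffun 'I_m -> seq word} -> bool.

(** Asked of every entry, whether or not its state is final: [check_v] evaluates the combinator
    before the test on the state selects a branch. *)
Definition check_runs (e : entry) : Prop :=
  [/\ small_entry e,
      forall i w, w \in e.2 i ->
        red (P 1) (A (A (C (fv i)) (C (enat k))) (C (eword w)))
          (C (ebool (finF i w))),
      forall i,
        red (P 1) (A (A (C (nv i)) (C (enat k))) (C (ewords (e.2 i))))
          (C (eword (invF i (e.2 i)))) &
      red (P 1)
        (A (A (C pc)
              (C (eseq [seq ebool (has (finF i) (e.2 i)) | i <- enum 'I_m])))
           (C (eseq [seq eword (invF i (e.2 i)) | i <- enum 'I_m])))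
        (C (ebool (cF e.2)))].

Definition check (e : entry) : bool := (e.1 \in finals) ==> cF e.2.

Lemma red_check e : size finals <= B -> check_runs e ->
  red (P 10)
    (A (A (A (A (A (C check_v) (C (enat k))) (C ecores)) (C pc))
             (C (eseq (map enat finals)))) (C (eent e)))
    (C (ebool (check e))).
Proof.
case: e => q T le_f [[/= le_q hT] hf hn hc]; start.
  rewrite /eent; unf check_v.
  rw (@red_has B hB _ enat (eq_op q) _ finals 3 le_f).
    move=> q' _; start.
      go.
      rw (@red_eqnat B hB q q' le_q).
      exact: red_refl.
    by cost.
  rw (@red_map2 B hB _ ecore (fun i => ewords (T i))
       (fun i => ebool (has (finF i) (T i))) _ _ 7 size_enum_m).
    move=> i _; start.
      rewrite /ecore; go.
      rw (@red_has B hB _ eword (finF i) _ (T i) 1).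
      - by have [] := hT i.
      - move=> w hw; start.
          go.
          rw (hf i w hw).
          exact: red_refl.
        by cost.
      exact: red_refl.
    by cost.
  rw (@red_map2 B hB _ ecore (fun i => ewords (T i))
       (fun i => eword (invF i (T i))) _ _ 2 size_enum_m).
    move=> i _; start.
      rewrite /ecore; go.
      rw (hn i).
      exact: red_refl.
    by cost.
  rw hc.
  go.
  rewrite (_ : has (eq_op q) finals = (q \in finals)); last first.
    by rewrite -has_pred1; apply: eq_has => q'; rewrite /= eq_sym.
  by rewrite /check /=; case: (q \in finals); exact: red_refl.
by cost.
Qed.

Lemma red_decide (pA : cval) n (E : pred entry) :
  red (P 1) (A (C pA) (C (enat k)))
    (C (etup [:: n; eseq (map enat finals); eseq (map erule rhos)])) ->
  size rhos <= B -> size finals <= B ->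
  (forall R, uniq R -> all E R -> fresh_runs R) ->
  (forall R, uniq R -> all E R -> all E (fresh R)) ->
  (forall e, E e -> check_runs e) ->
  exists R, [/\ all E R, fresh R = [::] &
    red (P 34)
      (A (A (A (A (C decide_v) (C pA)) (C ecores)) (C pc)) (C (enat k)))
      (C (ebool (all check R)))].
Proof.
move=> hA le_r le_f hF hE hC.
have [R [uR aR fR hR]] :=
  @red_loop_from E le_r hF hE B [::] (leq_subr _ _) isT isT.
have hR' : red (P 33) (A (A (C loop_v) (C fresh_clos)) (C (eseq [::])))
    (C (eseq (map eent R))).
  by apply: red_le hR _; apply: loop_cost.
exists R; split=> //; start.
  unf decide_v.
  rw hA.
  go.
  rw hR'.
  rw (@red_all B hB _ eent check _ R 10).
  - by have [] := hF R uR aR.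
  - move=> e he; start.
      go.
      rw (@red_check e le_f); first by apply/hC/(allP aR).
      exact: red_refl.
    by cost.
  exact: red_refl.
by cost.
Qed.
End Cores.
End Run.

(** * Correctness of saturation *)

Lemma listsP ws (S : {fset word}) :
  reflect (uniq ws /\ ws =i S) (lists ws S).
Proof.
apply: (iffP idP) => [h|[u e]].
  by split; [rewrite (perm_uniq h) fset_uniq|exact: perm_mem h].
by apply: uniq_perm => //; apply: fset_uniq.
Qed.

Lemma lists_fset (ws : seq word) : uniq ws -> lists ws [fset w in ws]%fset.
Proof. by move=> u; apply/listsP; split=> // w; rewrite in_fset. Qed.

Lemma lists_fsetE ws (S : {fset word}) : lists ws S -> S = [fset w in ws]%fset.
Proof. by move=> /listsP[_ h]; apply/fsetP => w; rewrite in_fset -h. Qed.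

Lemma mem_choices (T : choiceType) (Ss : seq {fset T}) ws :
  (ws \in choices Ss) = all2 (fun w (S : {fset T}) => w \in S) ws Ss.
Proof.
elim: Ss ws => [|S Ss IH] [|w ws] //=.
  by apply/negbTE/negP => /allpairsP[[x y]] [].
apply/allpairsP/andP => [[[x ys] /= [hx hys [-> ->]]]|[hw hws]].
  by rewrite -IH.
by exists (w, ws); rewrite /= IH.
Qed.

Lemma in_union_trans (C : core) k a Ss w :
  reflect (exists2 ws, ws \in choices Ss & w \in trans C k a ws)
    (w \in union_trans C k a Ss).
Proof.
apply: (iffP (bigfcupP _ _ _ _)) => [[ws /andP[h _] h']|[ws h h']]; exists ws => //.
by rewrite h.
Qed.

Section WitnessSets.
Variables (C : core) (k : nat).
Hypothesis hC : treelike_dp_core C.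

Lemma wit_union a Ss : a \in sigma C k -> size Ss = arity a ->
  (forall S, S \in Ss -> wit_set C k S) -> wit_set C k (union_trans C k a Ss).
Proof.
move=> ha sz hS w /in_union_trans[ws]; rewrite mem_choices => hws.
have [h _] := hC; apply: h => //.
  by have := hws; rewrite all2E => /andP[/eqP -> _].
elim: Ss ws {sz} hS hws => [|S Ss IH] [|v ws] //= hS /andP[hv hws].
rewrite IH // ?andbT; last by move=> S' h'; apply: hS; rewrite in_cons h' orbT.
by apply: hS hv; rewrite mem_head.
Qed.

Lemma wit_Dyn t : in_terms (sigma C k) t -> wit_set C k (Dyn C k t).
Proof.
elim/term_nested_ind: t => a ts IH /= /and3P[ha /eqP sz hts].
have hts' S : S \in map (Dyn C k) ts -> wit_set C k S.
  elim: ts IH {sz} hts => //= t ts IHts IH /andP[ht hts].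
  rewrite in_cons => /predU1P[->|h]; first by apply: IH => //; left.
  by apply: IHts => // u hu; apply: IH; right.
have [h1 h2] := hC; case: ts IH sz hts hts' => [|t ts] _ sz _ hts' /=.
  by apply: h1.
by apply: h2; apply: wit_union => //=; rewrite size_map.
Qed.
End WitnessSets.

Lemma reaches_in_terms Sigma (A : tree_automaton) t q :
  ta_over Sigma A -> reaches A t q -> in_terms Sigma t.
Proof.
move=> /andP[_ /allP hA]; elim/term_nested_ind: t q => a ts IH q /=.
case/hasP=> -[[b qs] q'] /hA /= /and4P[hb /eqP sz _ _] /and3P[/eqP eb h _].
rewrite -{1}eb hb -eb -sz; have := h; rewrite all2E => /andP[-> _] /=.
elim: ts qs {sz} IH h => //= t ts IHts [|q1 qs] //= IH /andP[h1 h].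
rewrite (IH t _ q1) //; last by left.
by apply: IHts h => u hu; apply: IH; right.
Qed.

Section Correctness.
Variables (D : decomposition) (A : tree_automaton) (k m : nat).
Variables (C : 'I_m -> core) (c : combinator m).
Hypothesis hA : recognizes D k A.
Hypothesis hC : forall i, treelike_dp_core (C i).
Hypothesis hsigma : forall i, sigma (C i) k = d_sigma D k.

Variables (leafF : 'I_m -> symbol -> seq word).
Variables (trF : 'I_m -> symbol -> seq word -> seq word).
Variables (clF : 'I_m -> seq word -> seq word).
Variables (invF : 'I_m -> seq word -> word).

Hypothesis leaf_lists : forall i a, a \in d_sigma D k -> arity a = 0 ->
  lists (leafF i a) (trans (C i) k a [::]).
Hypothesis tr_lists : forall i a ws, a \in d_sigma D k -> 0 < arity a ->
  size ws = arity a -> all (wit (C i) k) ws ->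
  lists (trF i a ws) (trans (C i) k a ws).
Hypothesis cl_lists : forall i ws S, wit_set (C i) k S -> lists ws S ->
  lists (clF i ws) (clean (C i) k S).
Hypothesis invFE : forall i ws S, wit_set (C i) k S -> lists ws S ->
  invF i ws = Defs.inv (C i) k S.

Local Notation Sigma := (d_sigma D k).
Local Notation step := (stepF leafF trF clF).
Local Notation tuple_lists T t :=
  (forall i, lists (T i) (Dyn (C i) k t)).

Implicit Types (R es : seq (entry m)) (rho : ta_rule).

Definition represents i (Ss : seq (seq word)) (ts : seq term) : bool :=
  all2 (fun S t => lists S (Dyn (C i) k t)) Ss ts.

Lemma represents_prodl i Ss ts ws : represents i Ss ts ->
  (ws \in prodl Ss) = (ws \in choices (map (Dyn (C i) k) ts)).
Proof.
rewrite mem_prodl mem_choices; elim: Ss ts ws => [|S Ss IH] [|t ts] [|w ws] //=.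
by case/andP=> /listsP[_ e] h; rewrite e (IH ts).
Qed.

Lemma prodl_wit i a Ss ts ws : a \in Sigma -> size ts = arity a ->
  all (in_terms Sigma) ts -> represents i Ss ts -> ws \in prodl Ss ->
  size ws = arity a /\ all (wit (C i) k) ws.
Proof.
move=> ha <- hts hr; rewrite (represents_prodl _ hr) mem_choices.
elim: ts ws {Ss hr} hts => [|t ts IH] [|w ws] //= /andP[ht hts] /andP[hw hws].
have [-> ->] := IH ws hts hws; split=> //; rewrite andbT.
by apply: (wit_Dyn (hC i) _ hw); rewrite hsigma.
Qed.

Lemma union_lists i a Ss ts : a \in Sigma -> 0 < arity a ->
  size ts = arity a -> all (in_terms Sigma) ts -> represents i Ss ts ->
  lists (unionF trF i a Ss) (union_trans (C i) k a (map (Dyn (C i) k) ts)).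
Proof.
move=> ha a_gt0 sz hts hr; apply/listsP; split; first exact: undup_uniq.
move=> w; rewrite mem_undup; apply/flattenP/in_union_trans.
  move=> [_ /mapP[ws hws ->] hw]; exists ws; first by rewrite -(represents_prodl _ hr).
  have [sz' hwit] := prodl_wit ha sz hts hr hws.
  by have /listsP[_ <-] := tr_lists ha a_gt0 sz' hwit.
move=> [ws]; rewrite -(represents_prodl _ hr) => hws hw.
exists (trF i a ws); first exact: map_f.
have [sz' hwit] := prodl_wit ha sz hts hr hws.
by have /listsP[_ ->] := tr_lists ha a_gt0 sz' hwit.
Qed.

Lemma wit_union_terms i a ts : a \in Sigma -> size ts = arity a ->
  all (in_terms Sigma) ts ->
  wit_set (C i) k (union_trans (C i) k a (map (Dyn (C i) k) ts)).
Proof.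
move=> ha sz hts; apply: wit_union => //; rewrite ?hsigma ?size_map //.
move=> S; elim: ts {sz} hts => //= t ts IH /andP[ht hts].
by rewrite in_cons => /predU1P[->|]; [apply: wit_Dyn; rewrite ?hsigma|apply: IH].
Qed.

Lemma step_lists i a Ss ts : a \in Sigma -> size ts = arity a ->
  all (in_terms Sigma) ts -> represents i Ss ts ->
  lists (step i a Ss) (Dyn (C i) k (Node a ts)).
Proof.
case: ts Ss => [|t ts] [|S Ss] // ha sz hts hr; first exact: leaf_lists.
have hw := @wit_union_terms i a _ ha sz hts.
by apply: (cl_lists hw (union_lists ha _ sz hts hr)); rewrite -sz.
Qed.

(** The invariant of the saturation: one term accounts for the state and for all the components at
    once. It is Boolean by classical logic and serves as the predicate E of the loop; no program
    evaluates it. *)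
Definition entry_of (e : entry m) : bool :=
  `[< exists t, reaches A t e.1 /\ tuple_lists e.2 t >].

Lemma pools_terms R qs es : all entry_of R -> es \in prodl (pools R qs) ->
  exists ts, [/\ all2 (reaches A) ts qs &
    forall i, represents i (comps [seq e.2 | e <- es] i) ts].
Proof.
move=> /allP hR; rewrite mem_prodl.
elim: qs es => [|q qs IH] [|e es] //=; first by exists [::].
case/andP; rewrite mem_filter => /andP[/eqP eq he] /IH[ts [h1 h2]].
have /asboolP[t [ht hl]] := hR e he; exists (t :: ts); split=> /=.
  by rewrite -eq ht.
by move=> i; rewrite hl h2.
Qed.

Lemma terms_pools R qs ts :
  (forall t q, List.In t ts -> reaches A t q ->
     exists2 e, e \in R & e.1 = q /\ tuple_lists e.2 t) ->
  all2 (reaches A) ts qs ->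
  exists2 es, es \in prodl (pools R qs) &
    forall i, represents i (comps [seq e.2 | e <- es] i) ts.
Proof.
elim: ts qs => [|t ts IH] [|q qs] //= hts.
  by move=> _; exists [::].
case/andP=> /(hts t) [|e he [eq hl]]; first by left.
case/IH=> [u q' hu|es hes hr]; first by apply: hts; right.
exists (e :: es); last by move=> i; rewrite /= hl hr.
change (e :: es \in prodl (pools R (q :: qs))).
rewrite mem_prodl /=; apply/andP; split; first by rewrite mem_filter eq eqxx.
by move: hes; rewrite mem_prodl.
Qed.

Lemma rule_ok rho : rho \in rules A ->
  rho.1.1 \in Sigma /\ size rho.1.2 = arity rho.1.1.
Proof.
by have [/andP[_ /allP h] _] := hA => /h /and4P[? /eqP ? _ _].
Qed.

Lemma reaches_all ts qs : all2 (reaches A) ts qs ->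
  size ts = size qs /\ all (in_terms Sigma) ts.
Proof.
have [h _] := hA; elim: ts qs => [|t ts IH] [|q qs] //= /andP[ht /IH[-> ->]].
by rewrite (reaches_in_terms h ht).
Qed.

Lemma cands_entry R rho : all entry_of R -> rho \in rules A ->
  all entry_of (cands leafF trF clF R rho).
Proof.
move=> hR hrho; apply/allP => _ /mapP[es hes ->].
have [ts [h1 h2]] := pools_terms hR hes; have [ha sz] := rule_ok hrho.
have [sz' hts] := reaches_all h1.
apply/asboolP; exists (Node rho.1.1 ts); split.
  by apply/hasP; exists rho; rewrite ?eqxx ?h1.
by move=> i; rewrite ffunE; apply: step_lists => //; rewrite sz'.
Qed.

Lemma fresh_entry R : all entry_of R ->
  all entry_of (fresh leafF trF clF (rules A) R).
Proof.
move=> hR; apply/allP => e; rewrite mem_filter => /andP[_].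
case/flattenP=> _ /mapP[rho hrho ->]; exact: (allP (cands_entry hR hrho)).
Qed.

(** Induction on the term: the rule applied at the root, with the entries found for the children,
    gives a candidate, which lies in R because nothing is fresh. Other listings of the same sets may
    be missing from R, but one listing is enough. *)
Lemma saturated R t q : fresh leafF trF clF (rules A) R = [::] ->
  reaches A t q -> exists2 e, e \in R & e.1 = q /\ tuple_lists e.2 t.
Proof.
move=> hR; have sub rho e : rho \in rules A -> e \in cands leafF trF clF R rho ->
    e \in R.
  move=> hrho he; apply: contraT => heR.
  suff: e \in fresh leafF trF clF (rules A) R by rewrite hR.
  rewrite mem_filter heR; apply/flattenP; exists (cands leafF trF clF R rho) => //.
  exact: map_f.
elim/term_nested_ind: t q => a ts IH q /= /hasP[rho hrho /and3P[ea h /eqP eq]].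
have [es hes hr] := terms_pools (fun t q' ht => IH t ht q') h.
have [ha sz] := rule_ok hrho; have [sz' hts] := reaches_all h.
exists (rho.2, newtuple leafF trF clF rho.1.1 [seq e.2 | e <- es]).
  by apply: sub hrho _; apply/mapP; exists es.
split=> // i; rewrite ffunE -(eqP ea); apply: step_lists => //.
by rewrite sz'.
Qed.

Definition accF (T : {ffun 'I_m -> seq word}) : bool :=
  c [tuple has (final (C i) k) (T i) | i < m] [tuple invF i (T i) | i < m].

Local Notation comb := (combination (d_sigma D) c C).

Lemma accepted_comb t : accepted comb k t =
  c [tuple accepted (C i) k t | i < m] [tuple Defs.inv (C i) k (Dyn (C i) k t) | i < m].
Proof.
rewrite /accepted Dyn_combination /has_final enum_fsetE enum_fset1 /= orbF.
by congr c; apply: eq_from_tnth => i; rewrite !tnth_mktuple.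
Qed.

Lemma accF_accepted (T : {ffun 'I_m -> seq word}) t : in_terms Sigma t -> tuple_lists T t ->
  accF T = accepted comb k t.
Proof.
move=> ht hT; rewrite accepted_comb /accF.
congr c; apply: eq_from_tnth => i; rewrite !tnth_mktuple.
  by rewrite /accepted /has_final (perm_has _ (hT i)).
by apply: invFE => //; apply: wit_Dyn; rewrite ?hsigma.
Qed.

Lemma all_check R : all entry_of R -> fresh leafF trF clF (rules A) R = [::] ->
  (all (check (final_states A) accF) R <->
   forall t, d_lang D k t -> accepted comb k t).
Proof.
move=> hE hR; have [hover hlang] := hA; split.
  move=> /allP h t /hlang /hasP[q hq ht].
  have [e he [eq hT]] := saturated hR ht.
  rewrite -(accF_accepted (reaches_in_terms hover ht) hT).
  by apply: (implyP (h e he)); rewrite eq.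
move=> h; apply/allP => e he; apply/implyP => hq.
have /asboolP[t [ht hT]] := allP hE e he.
rewrite (accF_accepted (reaches_in_terms hover ht) hT); apply: h; apply/hlang.
by apply/hasP; exists e.1.
Qed.
End Correctness.

(** * From inclusion of graph properties to acceptance of terms *)

Lemma graph_iso_refl G : graph_iso G G.
Proof.
by exists id, id; split=> //; split=> //; apply/fsetP => x;
  apply/imfsetP/idP => [[y hy ->]|hx] //; exists x.
Qed.

(** The graph of a term of level k may belong to the core property through another term at another
    level. Coherence of each core equates the acceptance bits and the invariants of the two terms,
    and the combinator sees nothing else. *)
Lemma inclusionE D k m (c : combinator m) (C : 'I_m -> core) :
  (forall i, coherent (C i) D) ->
  (forall G, class_property D k G ->
     core_property (combination (d_sigma D) c C) D G) <->
  (forall t, d_lang D k t -> accepted (combination (d_sigma D) c C) k t).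
Proof.
move=> hC; split.
  move=> h t ht.
  have hG : class_property D k (d_graph D k t).
    by exists (d_graph D k t); [exists t|exact: graph_iso_refl].
  have [k' [_ [t' [ht' acc] ->] iso]] := h _ hG.
  move: acc; rewrite !accepted_comb; congr is_true; symmetry.
  by congr c; apply: eq_from_tnth => i; rewrite !tnth_mktuple;
    have [_ h'] := hC i; have [] := h' k k' t t' ht ht' iso.
move=> h G [_ [t ht ->] iso]; exists k, (d_graph D k t) => //.
by exists t => //; split=> //; apply: h.
Qed.

(** The left side of the inclusion grows with the level while the right side, a union over all
    levels, is fixed. *)
Lemma inclusion_antitone r D m (c : combinator m) (C : 'I_m -> core) k k' :
  treelike_class r D -> k <= k' ->
  (forall G, class_property D k' G ->
     core_property (combination (d_sigma D) c C) D G) ->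
  (forall G, class_property D k G ->
     core_property (combination (d_sigma D) c C) D G).
Proof.
move=> hD le_k h G [_ [t ht ->] iso]; apply: h.
have [ht' e] : d_lang D k' t /\ d_graph D k' t = d_graph D k t.
  elim: k' le_k => [|k' IH]; first by rewrite leqn0 => /eqP <-.
  rewrite leq_eqVlt => /predU1P[<- //|/IH[h1 h2]].
  by split; [apply: (tc_lang_mono hD)|rewrite (tc_graph_ext hD)].
by exists (d_graph D k t) => //; exists t.
Qed.

(** * Sizes of useful sets and of encodings *)

(** The bound M only ensures that a maximum exists, since [natmax] falls back to 0 on unbounded
    sets; its value is irrelevant. *)
Lemma natmax_ge (A : nat -> Prop) M a :
  (forall b, A b -> b <= M) -> A a -> a <= natmax A.
Proof.
move=> hM ha.
have ex : exists b, `[< A b >] by exists a; apply/asboolP.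
have hM' b : `[< A b >] -> b <= M by move/asboolP; apply: hM.
have exmax : exists b, A b /\ forall a, A a -> a <= b.
  case: (ex_maxnP ex hM') => b /asboolP hb max_b.
  by exists b; split=> // a' ha'; apply: max_b; apply/asboolP.
by have [_ h] := xgetPex 0 exmax; apply: h.
Qed.

Lemma natmax_le (A : nat -> Prop) M : (forall b, A b -> b <= M) -> natmax A <= M.
Proof. by move=> hM; rewrite /natmax; case: xgetP => [b _ [hb _]|//]; apply: hM. Qed.

(** Makes the measures at fixed n true maxima. The children of a term with at most n + 1 nodes have
    at most n nodes, so their values come from the list obtained for n. *)
Lemma useful_sets_finite (C : core) k n :
  exists l : seq {fset word}, forall S, useful_set C k n S -> S \in l.
Proof.
elim: n => [|n [l hl]].
  by exists [::] => S [[a ts] []].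
exists (flatten [seq [seq set_trans C k a Ss | Ss <- prodl (nseq (arity a) l)]
                   | a <- enum_fset (sigma C k)]).
move=> _ [[a ts] [/= /and3P[ha /eqP sz hts] le_n ->]].
apply/flattenP; exists [seq set_trans C k a Ss | Ss <- prodl (nseq (arity a) l)].
  by apply: (map_f (fun a => [seq set_trans C k a Ss | Ss <- prodl (nseq (arity a) l)])).
apply: map_f; rewrite mem_prodl -sz.
elim: ts {sz} hts le_n => //= t ts IH /andP[ht hts] le_n.
by rewrite IH // ?andbT; [apply: hl; exists t; split=> //; lia | lia].
Qed.

Fixpoint words_upto (n : nat) : seq word :=
  if n is n'.+1 then [::] :: [seq b :: w | b <- [:: true; false], w <- words_upto n']
  else [:: [::]].

Lemma mem_words_upto n (w : word) : size w <= n -> w \in words_upto n.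
Proof.
elim: n w => [|n IH] [|b w] //= le_w; rewrite in_cons !mem_cat.
by have := map_f (cons b) (IH w le_w); case: b => ->; rewrite ?orbT.
Qed.

Lemma size_words_upto n : (size (words_upto n)).+1 = 2 ^ n.+1.
Proof.
elim: n => //= n IH; by rewrite !size_cat !size_map /= addn0 expnS -IH mulnS mul2n -addnn.
Qed.

(* The algorithm compares sets of witnesses as lists, so that a set listed in two
   orders counts twice; the bound for lists is still 2 ^ ((beta + 1) * mu). *)
Definition lists_upto (n u : nat) : seq (seq word) :=
  [seq pmap id x | x <- prodl (nseq u (None :: map Some (words_upto n)))].

(** Lists of at most u words are sequences of exactly u optional words with the pads erased. There
    are 2^(n+1) - 1 words of length at most n, and the pad brings the choices at each position to
    exactly 2^(n+1). *)
Lemma size_lists_upto n u : size (lists_upto n u) <= 2 ^ (n.+1 * u).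
Proof.
rewrite size_map expnM; set L := None :: _.
have -> : 2 ^ n.+1 = size L by rewrite /= size_map size_words_upto.
have := @size_prodl_le _ (nseq u L) (size L); rewrite size_nseq; apply.
by move=> x; rewrite mem_nseq => /andP[_ /eqP ->].
Qed.

Lemma mem_lists_upto n u ws : size ws <= u -> (forall w, w \in ws -> size w <= n) ->
  ws \in lists_upto n u.
Proof.
move=> le_u h; apply/mapP; exists (map Some ws ++ nseq (u - size ws) None).
  rewrite mem_prodl; elim: u ws le_u h => [|u IH] [|w ws] //= le_u h.
    by have := IH [::]; rewrite subn0; apply.
  rewrite in_cons map_f ?orbT; last by apply/mem_words_upto/h/mem_head.
  by apply: IH => // v hv; apply: h; rewrite in_cons hv orbT.
rewrite pmap_cat; have -> j : pmap id (nseq j None) = [::] :> seq word by elim: j.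
by rewrite cats0; elim: (ws) => //= w s <-.
Qed.

Section Measures.
Variables (C : core) (k : nat).
Hypothesis fC : finite_core C.
Local Notation beta := (bitlength_sup C k).
Local Notation mu := (multiplicity_sup C k).

Lemma useful_wit_bitlength n w : useful_wit C k n w -> size w <= bitlength C k n.
Proof.
have [l hl] := useful_sets_finite C k n.
move=> hw; apply: (@natmax_ge _ (\max_(S <- l) \max_(w <- enum_fset S) size w)).
  move=> _ [v [S hS hv] ->].
  have h1 := @leq_bigmax_seq _ l xpredT
    (fun S : {fset word} => \max_(w <- enum_fset S) size w) S (hl S hS) isT.
  exact: leq_trans (@leq_bigmax_seq _ (enum_fset S) xpredT size v hv isT) h1.
by exists w.
Qed.

Lemma bitlength_le_sup n : bitlength C k n <= beta.
Proof.
have [g hg] := fC; apply: (@natmax_ge _ (g k)); last by exists n.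
by move=> _ [n' ->].
Qed.

Lemma card_useful_le n S : useful_set C k n S -> #|` S|%fset < 2 ^ beta.+1.
Proof.
move=> hS; rewrite -size_words_upto ltnS.
rewrite cardfE cardE; rewrite -cardE -cardfE.
apply: uniq_leq_size; first exact: fset_uniq.
move=> w hw; apply: mem_words_upto; apply: leq_trans (bitlength_le_sup n).
by apply: useful_wit_bitlength; exists S.
Qed.

Lemma card_useful_multiplicity n S : useful_set C k n S -> #|` S|%fset <= multiplicity C k n.
Proof.
move=> hS; apply: (@natmax_ge _ (2 ^ beta.+1)); last by exists S.
by move=> _ [S' /card_useful_le/ltnW h ->].
Qed.

(** The subtraction of 1 matters: for beta = 0 it leaves a multiplicity of at most 1, which keeps
    the degenerate cases of the final bound correct. *)
Lemma multiplicity_le n : multiplicity C k n <= 2 ^ beta.+1 - 1.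
Proof.
apply: natmax_le => _ [S /card_useful_le h ->]; lia.
Qed.

Lemma multiplicity_le_sup n : multiplicity C k n <= mu.
Proof.
apply: (@natmax_ge _ (2 ^ beta.+1)); last by exists n.
by move=> _ [n' ->]; apply: leq_trans (multiplicity_le n') _; lia.
Qed.

Lemma mu_le : mu <= 2 ^ beta.+1 - 1.
Proof. by apply: natmax_le => _ [n ->]; apply: multiplicity_le. Qed.

(** A useful witness lies in a useful set, which is then nonempty; if mu is 0 there are no useful
    witnesses and every maximum of lengths is 0. *)
Lemma mu_gt0 : 0 < beta -> 0 < mu.
Proof.
rewrite !lt0n; apply: contra => /eqP mu0; rewrite -leqn0; apply: natmax_le => _ [n ->].
apply: natmax_le => b [w [S hS hw] _].
have := leq_trans (card_useful_multiplicity hS) (multiplicity_le_sup n).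
by rewrite mu0 leqn0 cardfs_eq0 => /eqP S0; rewrite S0 in_fset0 in hw.
Qed.

Lemma lists_Dyn_bounds t ws : in_terms (sigma C k) t -> lists ws (Dyn C k t) ->
  size ws <= mu /\ forall w, w \in ws -> size w <= beta.
Proof.
move=> ht hws; have hu : useful_set C k (term_size t) (Dyn C k t) by exists t.
split.
  rewrite (perm_size hws).
  exact: leq_trans (card_useful_multiplicity hu) (multiplicity_le_sup _).
move=> w hw; apply: leq_trans (bitlength_le_sup (term_size t)).
apply: useful_wit_bitlength; exists (Dyn C k t) => //.
by have /listsP[_ <-] := hws.
Qed.
End Measures.

(** Times include the size of the output, so lower bounds on encodings turn a running time into a
    bound on the data produced. *)
Lemma lam_size_enc_seq xs :
  size xs <= lam_size (enc_seq xs) /\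
  forall P : lam -> nat, (forall x, P x <= lam_size x) ->
  forall x, List.In x xs -> P x <= lam_size (enc_seq xs).
Proof.
elim: xs => //= x xs [le_s IH]; split; first lia.
move=> P hP y [<-|hy]; first by have := hP x; lia.
by have := IH P hP y hy; lia.
Qed.

Lemma In_map (T U : Type) (f : T -> U) x s : List.In x s -> List.In (f x) (map f s).
Proof. by elim: s => //= y s IH [->|/IH]; [left|right]. Qed.

Lemma mem_In (T : eqType) (x : T) s : x \in s -> List.In x s.
Proof. by elim: s => //= y s IH; rewrite in_cons => /predU1P[->|/IH]; [left|right]. Qed.

Lemma lam_size_enc_word w : size w <= lam_size (enc_word w).
Proof. by have [h _] := lam_size_enc_seq (map enc_bool w); rewrite size_map in h. Qed.

Lemma lam_size_enc_seq_map (T : eqType) (f : T -> lam) (xs : seq T) :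
  size xs <= lam_size (enc_seq (map f xs)) /\
  forall x, x \in xs -> lam_size (f x) <= lam_size (enc_seq (map f xs)).
Proof.
have [h1 h2] := lam_size_enc_seq (map f xs); rewrite size_map in h1; split=> // x hx.
exact: (h2 lam_size (fun _ => leqnn _) (f x) (In_map f (mem_In hx))).
Qed.

Lemma lam_size_enc_words ws :
  size ws <= lam_size (enc_words ws) /\
  forall w, w \in ws -> size w <= lam_size (enc_words ws).
Proof.
have [h1 h2] := lam_size_enc_seq_map enc_word ws; split=> // w /h2.
exact: leq_trans (lam_size_enc_word w).
Qed.

Lemma lam_size_enc_nat n : n <= lam_size (enc_nat n).
Proof. by elim: n => //= n IH; lia. Qed.

Lemma lam_size_enc_automaton (A : tree_automaton) t :
  lam_size (enc_automaton A) <= t ->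
  [/\ nstates A <= t, size (final_states A) <= t, size (rules A) <= t &
      forall rho, rho \in rules A -> symbol_size rho.1.1 <= t].
Proof.
rewrite /enc_automaton /enc_tuple /apps /= => h.
have h1 := lam_size_enc_nat (nstates A).
have [h2 _] := lam_size_enc_seq_map enc_nat (final_states A).
have [h3 h4] := lam_size_enc_seq_map enc_rule (rules A).
set a1 := lam_size _ in h1 h; set a2 := lam_size _ in h2 h.
set a3 := lam_size _ in h3 h4 h.
have [le1 le2 le3] : [/\ a1 <= t, a2 <= t & a3 <= t] by split; lia.
split; [exact: leq_trans h1 le1|exact: leq_trans h2 le2|exact: leq_trans h3 le3|].
case=> [[[w n] qs] q] /h4 h5; apply: leq_trans le3; apply: leq_trans h5.
rewrite /enc_rule /enc_symbol /enc_tuple /apps /symbol_size /arity /=.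
by have := lam_size_enc_word w; have := lam_size_enc_nat n; lia.
Qed.

Lemma words_size_le ws n b : size ws <= n -> (forall w, w \in ws -> size w <= b) ->
  words_size ws <= n * b.+1.
Proof.
move=> le_n h; apply: leq_trans (_ : size ws * b.+1 <= _); last first.
  by rewrite leq_mul2r le_n orbT.
rewrite /words_size -sum1_size big_distrl /= big_seq [leqRHS]big_seq.
by apply: leq_sum => w /h; rewrite mul1n.
Qed.

(** * Running time at one level *)

(** Used to extract the output lists of the core programs as total functions, with the default [y0]
    where nothing is specified. *)
Lemma cond_choice (X Y : Type) (y0 : Y) (P : X -> Prop) (Q : X -> Y -> Prop) :
  (forall x, P x -> exists y, Q x y) -> exists F, forall x, P x -> Q x (F x).
Proof.
move=> h; have h' x : exists y, P x -> Q x y.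
  by have [/h[y hy]|nP] := pselect (P x); [exists y | exists y0].
by have [F hF] := choice h'; exists F.
Qed.

Lemma cond_choice2 (X1 X2 Y : Type) (y0 : Y) (P : X1 -> X2 -> Prop)
    (Q : X1 -> X2 -> Y -> Prop) :
  (forall x1 x2, P x1 x2 -> exists y, Q x1 x2 y) ->
  exists F, forall x1 x2, P x1 x2 -> Q x1 x2 (F x1 x2).
Proof.
move=> h; have [F hF] := @cond_choice (X1 * X2) Y y0 (fun x => P x.1 x.2)
  (fun x => Q x.1 x.2) (fun x => h x.1 x.2).
by exists (fun x1 x2 => F (x1, x2)) => x1 x2; apply: (hF (x1, x2)).
Qed.

Lemma cond_choice3 (X1 X2 X3 Y : Type) (y0 : Y) (P : X1 -> X2 -> X3 -> Prop)
    (Q : X1 -> X2 -> X3 -> Y -> Prop) :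
  (forall x1 x2 x3, P x1 x2 x3 -> exists y, Q x1 x2 x3 y) ->
  exists F, forall x1 x2 x3, P x1 x2 x3 -> Q x1 x2 x3 (F x1 x2 x3).
Proof.
move=> h; have [F hF] := @cond_choice2 (X1 * X2) X3 Y y0
  (fun x => P x.1 x.2) (fun x => Q x.1 x.2) (fun x => h x.1 x.2).
by exists (fun x1 x2 => F (x1, x2)) => x1 x2; apply: (hF (x1, x2)).
Qed.

Lemma outputs_red t s s' v v' : outputs t s v -> tmlam s' = s -> vl v' = v ->
  red t s' (C v') /\ lam_size v <= t.
Proof.
move=> [n ev le_n] es ev'; split; last by lia.
by apply: (@eval_red _ n); [rewrite es ev'|lia].
Qed.

Lemma poly_le e n n' : n <= n' -> poly e n <= poly e n'.
Proof.
move=> le_n; rewrite /poly leq_mul2l; apply/orP; right.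
by case: e => // e; rewrite leq_exp2r.
Qed.

(** Origin of the exponent 5 in [clean_time]: the level k and a raw union, whose size is a product
    of three quantities below y, form the input of the cleaning program. *)
Lemma add_cube_le a b y : 64 <= y -> a <= y -> b <= y * y * y -> a + b <= y ^ 5.
Proof.
move=> hy ha hb; have -> : y ^ 5 = y * y * y * (y * y) by rewrite !expnS expn0; lia.
have : y * y * y * 2 <= y * y * y * (y * y) by rewrite leq_mul2l; nia.
have : y <= y * y * y by nia.
by lia.
Qed.

(* Z bounds the sizes of the data at one level, and each further budget adds the
   running time of the programs whose input sizes the previous one controls. *)
Section Budget.
Variables (e Z : nat).
Definition trans_time := poly e (Z ^ 3).
Definition trans_budget := Z + trans_time.
Definition clean_time := poly e (trans_budget ^ 5).
Definition clean_budget := trans_budget + clean_time.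
(** The square covers products of two sizes: the raw unions and the list of all candidates. The cube
    covers the input of the combinator: m bits and m invariants, each no longer than the time needed
    to write it. *)
Definition budget := clean_budget ^ 2 + poly e (clean_budget ^ 3).

Hypothesis hZ : 64 <= Z.

Lemma le_trans_budget : Z <= trans_budget /\ trans_time < trans_budget.
Proof. by rewrite /trans_budget; lia. Qed.

Lemma le_clean_budget : trans_budget <= clean_budget /\ clean_time < clean_budget.
Proof. by rewrite /clean_budget /trans_budget; lia. Qed.

Lemma le_budget :
  [/\ clean_budget ^ 2 <= budget, clean_budget <= budget &
      poly e (clean_budget ^ 3) <= budget].
Proof.
rewrite /budget; split; rewrite ?leq_addr ?leq_addl //.
by rewrite expnS expn1; have [] := le_clean_budget; have [] := le_trans_budget; nia.
Qed.

Lemma Z_le_budget : Z <= budget.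
Proof.
have [_ h _] := le_budget; have [h1 _] := le_clean_budget.
by have [h2 _] := le_trans_budget; lia.
Qed.

Lemma sqr_le_budget a b : a <= clean_budget -> b <= clean_budget -> a * b <= budget.
Proof.
move=> ha hb; have [h _ _] := le_budget; apply: leq_trans h.
by rewrite expnS expn1 leq_mul.
Qed.
End Budget.

(** * The complete run at a fixed level *)

Section Level.
Variables (e r : nat) (D : decomposition) (Aut : tree_automaton) (pA : cval).
Variables (m : nat) (Cs : 'I_m -> core) (pC : 'I_m -> core_program).
Variables (c : combinator m) (pc : cval) (k : nat).
(** M bounds the size of a value of one core, W the number of lists for one core and N the number of
    entries. Powers with exponent r1 count the choices for the children of a node, of witnesses for
    M and of entries for N. *)
Variables (Z beta M W N : nat).
Local Notation r1 := (maxn 1 r).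

Hypothesis hD : treelike_class r D.
Hypothesis hA : recognizes D k Aut.
Hypothesis outA : outputs Z (App (vl pA) (enc_nat k)) (enc_automaton Aut).
Hypothesis hC : forall i, treelike_dp_core (Cs i).
Hypothesis fC : forall i, finite_core (Cs i).
Hypothesis pol : forall i, internally_polynomial_with e (Cs i) (pC i).
Hypothesis coh : forall i, coherent (Cs i) D.
Hypothesis polc : polynomial_combinator_with e c (vl pc).

Hypothesis hZ : 64 <= Z.
Hypothesis le_k : k <= Z.
Hypothesis le_m : m <= Z.
Hypothesis le_r : r1 <= Z.
Hypothesis lt_beta : beta < Z.
Hypothesis hbeta : forall i, bitlength_sup (Cs i) k <= beta.
Hypothesis hM : forall i, multiplicity_sup (Cs i) k <= M.
Hypothesis M_gt0 : 0 < M.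
Hypothesis le_M : M ^ r1 <= Z.
Hypothesis hW : forall i,
  2 ^ ((bitlength_sup (Cs i) k).+1 * multiplicity_sup (Cs i) k) <= W.
Hypothesis hN : nstates Aut * W ^ m <= N.
Hypothesis N_gt0 : 0 < N.
Hypothesis le_N : N ^ r1 <= Z.

Local Notation Sigma := (d_sigma D k).
Local Notation B := (budget e Z).
Local Notation TT := (trans_time e Z).
Local Notation Y := (trans_budget e Z).
Local Notation CT := (clean_time e Z).
Local Notation X := (clean_budget e Z).

Let hsigma i : sigma (Cs i) k = Sigma. Proof. by have [] := coh i. Qed.

Let procs i : [/\ procedure (p_wit (pC i)), procedure (p_leaf (pC i)),
  procedure (p_trans (pC i)), procedure (p_final (pC i)) &
  procedure (p_clean (pC i)) /\ procedure (p_inv (pC i))].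
Proof. by have /= /and5P[-> -> -> -> /andP[-> /andP[->]]] := ip_procedures (pol i). Qed.

Definition wit_c i : cval := CVal (let: And5 h _ _ _ _ := procs i in h).
Definition leaf_c i : cval := CVal (let: And5 _ h _ _ _ := procs i in h).
Definition trans_c i : cval := CVal (let: And5 _ _ h _ _ := procs i in h).
Definition final_c i : cval := CVal (let: And5 _ _ _ h _ := procs i in h).
Definition clean_c i : cval := CVal (let: And5 _ _ _ _ (conj h _) := procs i in h).
Definition inv_c i : cval := CVal (let: And5 _ _ _ _ (conj _ h) := procs i in h).

Let hB : 64 <= B.
Proof. exact: leq_trans hZ (Z_le_budget e hZ). Qed.

Let leB n : n <= TT \/ n <= CT \/ n <= Z -> n <= B.
Proof.
have := Z_le_budget e hZ; have [_ h1 _] := le_budget e hZ.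
have [h2 h3] := le_clean_budget e hZ; have [h4 h5] := le_trans_budget e hZ.
by move: h1 h2 h3 h4 h5; set b := B; set x := X; set y := Y; set t := TT; set c' := CT; lia.
Qed.

Let le_MZ : M <= Z.
Proof. by apply: leq_trans le_M; rewrite -{1}(expn1 M) leq_pexp2l // leq_maxl. Qed.

Let le_NZ : N <= Z.
Proof. by apply: leq_trans le_N; rewrite -{1}(expn1 N) leq_pexp2l // leq_maxl. Qed.

Let le_time a b d : a <= Z -> b <= Z -> d <= Z * Z -> poly e (a + b + d) <= TT.
Proof.
by move=> ha hb hd; apply: poly_le; rewrite !expnS expn0 muln1; nia.
Qed.

(** The list is needed for the whole alphabet, but the time only for symbols of size at most Z. The
    symbols in the rules of the automaton are that small because [pA] has to write them. *)
Lemma leaf_run (i : 'I_m) (a : symbol) :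
  a \in Sigma /\ arity a = 0 ->
  exists ws, lists ws (trans (Cs i) k a [::]) /\ (symbol_size a <= Z ->
    red TT (A (A (C (leaf_c i)) (C (enat k))) (C (esymb a))) (C (ewords ws))).
Proof.
move=> [ha a0].
have := @ip_leaf _ _ _ (pol i) k; rewrite hsigma => /(_ a ha a0) [ws hws out].
exists ws; split=> // sa.
have [||h _] := @outputs_red _ _ (A (A (C (leaf_c i)) (C (enat k))) (C (esymb a)))
  _ (ewords ws) out.
- by rewrite -vl_esymb.
- exact: vl_ewords.
apply: red_le h _; apply: le_time => //.
have h1 := leq_trans (bitlength_le_sup k (fC i) 1) (hbeta i).
have h2 := leq_trans (multiplicity_le_sup k (fC i) 1) (hM i).
by apply: leq_mul; [lia|exact: leq_trans h2 le_MZ].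
Qed.

Lemma trans_run (i : 'I_m) (a : symbol) (ws : seq word) :
  [/\ a \in Sigma, 0 < arity a, size ws = arity a & all (wit (Cs i) k) ws] ->
  exists vs, lists vs (trans (Cs i) k a ws) /\
  (symbol_size a <= Z -> (forall w, w \in ws -> size w <= beta) ->
     [/\ red TT (A (A (A (C (trans_c i)) (C (enat k))) (C (esymb a)))
            (C (ewords ws))) (C (ewords vs)),
         size vs <= TT & forall w, w \in vs -> size w <= TT]).
Proof.
move=> [ha a0 sz hws].
have := @ip_trans _ _ _ (pol i) k; rewrite hsigma.
move=> /(_ a ws ha a0 sz hws) [vs hvs out]; exists vs; split=> // sa hb.
have le_t : poly e (k + symbol_size a + words_size ws) <= TT.
  apply: le_time => //; apply: leq_trans (words_size_le (leqnn _) hb) _.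
  apply: leq_mul => //; rewrite sz; apply: leq_trans le_r.
  by rewrite leq_max (tc_arity hD ha) orbT.
have [||h hs] := @outputs_red _ _
  (A (A (A (C (trans_c i)) (C (enat k))) (C (esymb a))) (C (ewords ws)))
  _ (ewords vs) out.
- by rewrite -vl_esymb -vl_ewords.
- exact: vl_ewords.
have [h1 h2] := lam_size_enc_words vs; have hs' := leq_trans hs le_t.
split; [exact: red_le h le_t | exact: leq_trans h1 hs' | move=> w hw].
exact: leq_trans (h2 w hw) hs'.
Qed.

(** The set is read off the list, so that the chosen output depends on the list alone. *)
Lemma clean_run (i : 'I_m) (ws : seq word) :
  uniq ws /\ wit_set (Cs i) k [fset w in ws]%fset ->
  exists vs, lists vs (clean (Cs i) k [fset w in ws]%fset) /\
    red (poly e (k + words_size ws))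
      (A (A (C (clean_c i)) (C (enat k))) (C (ewords ws))) (C (ewords vs)).
Proof.
move=> [u hw].
have [vs hvs out] := ip_clean (pol i) hw (lists_fset u); exists vs; split=> //.
have [||h _] := @outputs_red _ _
  (A (A (C (clean_c i)) (C (enat k))) (C (ewords ws))) _ (ewords vs) out => //.
- by rewrite -vl_ewords.
- exact: vl_ewords.
Qed.

Lemma rule_bounds rho : rho \in rules Aut ->
  [/\ symbol_size rho.1.1 <= Z, size rho.1.2 <= r1 & rho.2 < nstates Aut].
Proof.
move=> hrho; have [n _ h] := outA.
have [_ _ _ hs] := lam_size_enc_automaton (leq_trans (leq_addl _ _) h).
have [ha sz] := rule_ok hA hrho; split; first exact: hs.
  by rewrite sz leq_max (tc_arity hD ha) orbT.
by have [/andP[_ /allP/(_ _ hrho)/and4P[]]] := hA.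
Qed.

Lemma reaches_state t q : reaches Aut t q -> q < nstates Aut.
Proof. by case: t => a ts /hasP[rho /rule_bounds[_ _ h] /and3P[_ _ /eqP <-]]. Qed.

Local Notation good := (entry_of Aut k Cs).

Lemma good_bounds (e0 : entry m) : good e0 ->
  e0.1 < nstates Aut /\ forall i, size (e0.2 i) <= multiplicity_sup (Cs i) k /\
    forall w, w \in e0.2 i -> size w <= bitlength_sup (Cs i) k.
Proof.
move=> /asboolP[t [ht hT]]; split; first exact: reaches_state ht.
move=> i; apply: (lists_Dyn_bounds (fC i) _ (hT i)).
by rewrite hsigma; have [h _] := hA; apply: reaches_in_terms h ht.
Qed.

Lemma good_small (e0 : entry m) : good e0 -> small_entry B e0.
Proof.
move=> /good_bounds[h1 h2]; have [n _ h] := outA.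
have [hn _ _ _] := lam_size_enc_automaton (leq_trans (leq_addl _ _) h).
split; first by apply: leB; right; right; lia.
move=> i; have [h3 h4] := h2 i; split.
  by apply: leB; right; right; apply: leq_trans (leq_trans h3 (hM i)) le_MZ.
move=> w /h4 h5; apply: leB; right; right.
by have := hbeta i; lia.
Qed.

(** Injects the entries into pairs of a state and a sequence of m bounded lists. Lists are counted,
    not sets, because the algorithm tells apart two orders of the same set. *)
Lemma size_good (R : seq (entry m)) : uniq R -> all good R -> size R <= N.
Proof.
move=> uR /allP hR; pose code (e0 : entry m) := (e0.1, map e0.2 (enum 'I_m)).
have inj : injective code.
  move=> [q T] [q' T'] [-> /eq_in_map eT]; congr pair.
  by apply/ffunP => i; apply: eT; rewrite mem_enum.
pose codes := [seq (q, x) | q <- iota 0 (nstates Aut), x <- prodl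
  [seq lists_upto (bitlength_sup (Cs i) k) (multiplicity_sup (Cs i) k)
     | i <- enum 'I_m]].
have : size (map code R) <= size codes.
  apply: uniq_leq_size; first by rewrite (map_inj_uniq inj).
  move=> _ /mapP[e0 /hR/good_bounds[h1 h2] ->]; apply/allpairsP.
  exists (code e0); split=> //=; first by rewrite mem_iota.
  rewrite mem_prodl; elim: (enum 'I_m) => //= i s ->; rewrite andbT.
  by have [h3 h4] := h2 i; apply: mem_lists_upto.
rewrite size_map size_allpairs size_iota => h; apply: leq_trans h _.
apply: leq_trans hN; rewrite leq_mul2l; apply/orP; right.
set xss := map _ _.
have szx : size xss = m by rewrite size_map size_enum_ord.
rewrite -[in X in _ <= X]szx; apply: size_prodl_le => _ /mapP[i _ ->].
exact: leq_trans (size_lists_upto _ _) (hW i).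
Qed.

Lemma size_prodl_pools (R : seq (entry m)) qs p s : uniq R -> all good R ->
  size qs <= r1 -> pools R qs = p ++ s -> size (prodl s) <= N ^ r1.
Proof.
move=> uR hR le_qs e0; apply: leq_trans (_ : N ^ size s <= _).
  apply: size_prodl_le => xs hxs.
  have : xs \in pools R qs by rewrite e0 mem_cat hxs orbT.
  case/mapP=> q _ ->; rewrite size_filter.
  exact: leq_trans (count_size _ _) (size_good uR hR).
rewrite leq_pexp2l //; apply: leq_trans le_qs.
by rewrite -(size_map (fun q => [seq e <- R | e.1 == q]) qs) -/(pools R qs) e0
  size_cat leq_addl.
Qed.

Section Fun.
Variables (leafF : 'I_m -> symbol -> seq word).
Variables (trF : 'I_m -> symbol -> seq word -> seq word).
Variables (clF : 'I_m -> seq word -> seq word).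
Hypothesis hleaf : forall i a, a \in Sigma /\ arity a = 0 ->
  lists (leafF i a) (trans (Cs i) k a [::]) /\ (symbol_size a <= Z ->
    red TT (A (A (C (leaf_c i)) (C (enat k))) (C (esymb a)))
      (C (ewords (leafF i a)))).
Hypothesis htr : forall i a ws,
  [/\ a \in Sigma, 0 < arity a, size ws = arity a & all (wit (Cs i) k) ws] ->
  lists (trF i a ws) (trans (Cs i) k a ws) /\
  (symbol_size a <= Z -> (forall w, w \in ws -> size w <= beta) ->
     [/\ red TT (A (A (A (C (trans_c i)) (C (enat k))) (C (esymb a)))
            (C (ewords ws))) (C (ewords (trF i a ws))),
         size (trF i a ws) <= TT &
         forall w, w \in trF i a ws -> size w <= TT]).
Hypothesis hcl : forall i ws,
  uniq ws /\ wit_set (Cs i) k [fset w in ws]%fset ->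
  lists (clF i ws) (clean (Cs i) k [fset w in ws]%fset) /\
    red (poly e (k + words_size ws))
      (A (A (C (clean_c i)) (C (enat k))) (C (ewords ws)))
      (C (ewords (clF i ws))).

Let leaf_lists i a : a \in Sigma -> arity a = 0 ->
  lists (leafF i a) (trans (Cs i) k a [::]).
Proof. by move=> ha a0; have [] := hleaf i (conj ha a0). Qed.

Let tr_lists i a ws : a \in Sigma -> 0 < arity a -> size ws = arity a ->
  all (wit (Cs i) k) ws -> lists (trF i a ws) (trans (Cs i) k a ws).
Proof. by move=> ha a0 sz hw; have [] := htr (And4 ha a0 sz hw). Qed.

Let cl_lists i ws S : wit_set (Cs i) k S -> lists ws S ->
  lists (clF i ws) (clean (Cs i) k S).
Proof.
move=> hS hws; have eS := lists_fsetE hws; rewrite eS in hS *.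
by have /listsP[u _] := hws; have [] := hcl (conj u hS).
Qed.

Definition invF (i : 'I_m) (ws : seq word) : word := Defs.inv (Cs i) k [fset w in ws]%fset.

Let invFE i ws S : wit_set (Cs i) k S -> lists ws S ->
  invF i ws = Defs.inv (Cs i) k S.
Proof. by move=> _ /lists_fsetE ->. Qed.

Lemma step_ok (R : seq (entry m)) rho es i : all good R -> rho \in rules Aut ->
  es \in prodl (pools R rho.1.2) ->
  step_runs B leaf_c trans_c clean_c k leafF trF clF i rho.1.1
    (comps [seq e0.2 | e0 <- es] i).
Proof.
move=> hR hrho hes; have [ts [h1 /(_ i) h2]] := pools_terms hR hes.
have [sz' hts] := reaches_all hA h1; have [ha sz] := rule_ok hA hrho.
have [hs hr _] := rule_bounds hrho; rewrite sz in sz'.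
have [_ sub_es] := prodl_pools hes.
have bd S : S \in comps [seq e0.2 | e0 <- es] i ->
    size S <= M /\ forall w, w \in S -> size w <= beta.
  move=> /mapP[_ /mapP[e0 he0 ->] ->].
  have [_ /(_ i)[b1 b2]] := good_bounds (allP hR _ (sub_es _ he0)).
  by split=> [|w /b2 b3];
    [exact: leq_trans b1 (hM i)|exact: leq_trans b3 (hbeta i)].
case def_Ss: (comps _ i) h2 bd => [|S0 Ss0] h2 bd.
  have [|_ /(_ hs) run] := hleaf i (a := rho.1.1).
    by split=> //; rewrite -sz'; case: (ts) h2.
  by apply: red_le run _; rewrite -(pw_B B); apply: leB; left.
set Ss := S0 :: Ss0 in def_Ss h2 bd *; have a_gt0 : 0 < arity rho.1.1.
  by rewrite -sz'; case: (ts) h2.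
have szS : size Ss <= r1.
  by rewrite -def_Ss /comps !size_map; have [-> _] := prodl_pools hes.
have wsP ws : ws \in prodl Ss ->
    [/\ size ws = arity rho.1.1, all (wit (Cs i) k) ws &
        forall w, w \in ws -> size w <= beta].
  move=> hws; have [w1 w2] := prodl_wit hC hsigma ha sz' hts h2 hws; split=> // w hw.
  by have [S /bd[_ b] /b] := prodl_elt hws hw.
have trP ws : ws \in prodl Ss ->
    [/\ red TT (A (A (A (C (trans_c i)) (C (enat k))) (C (esymb rho.1.1)))
            (C (ewords ws))) (C (ewords (trF i rho.1.1 ws))),
         size (trF i rho.1.1 ws) <= TT &
         forall w, w \in trF i rho.1.1 ws -> size w <= TT].
  by move=> hws; have [w1 w2 w3] := wsP ws hws;
    have [_] := htr (And4 ha a_gt0 w1 w2); apply.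
have le_prod p s : Ss = p ++ s -> size (prodl s) <= Z.
  move=> e0; apply: leq_trans le_M; apply: leq_trans (_ : M ^ size s <= _).
    by apply: size_prodl_le => S hS; have [] := bd S; rewrite // e0 mem_cat hS orbT.
  by rewrite leq_pexp2l //; apply: leq_trans szS; rewrite e0 size_cat leq_addl.
have [lY1 lY2] := le_trans_budget e hZ; have [lX1 lX2] := le_clean_budget e hZ.
(* The multiplicity says nothing before cleaning: there are at most Z choices of witnesses, and a
   transition has time to write at most TT words for each. *)
have le_flat : size (flatten [seq trF i rho.1.1 ws | ws <- prodl Ss]) <= Z * TT.
  apply: leq_trans (_ : size (prodl Ss) * TT <= _).
    rewrite -(size_map (trF i rho.1.1)); apply: size_flatten_le.
    by move=> _ /mapP[ws /trP[_ b _] ->].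
  by rewrite leq_mul2r (le_prod [::]) ?orbT.
split.
- by move=> p s /le_prod h; apply: leB; right; right.
- move=> ws /trP[run b1 b2]; split; last first.
    by split; [apply: leB; left|move=> w /b2 b3; apply: leB; left].
  by apply: red_le run _; rewrite -(pw_B B); apply: leB; left.
- apply: leq_trans le_flat _; apply: sqr_le_budget => //; lia.
have hun := union_lists hC hsigma tr_lists ha a_gt0 sz' hts h2.
have [|_ run] := hcl (i := i) (ws := unionF trF i rho.1.1 Ss).
  split; first by have /listsP[] := hun.
  rewrite -(lists_fsetE hun); exact: (@wit_union_terms _ _ _ _ hC hsigma).
apply: red_le run _; rewrite -(pw_B B); apply: leB; right; left.
apply: poly_le; apply: leq_trans (_ : k + (Z * TT) * TT.+1 <= _).
  rewrite leq_add2l; apply: words_size_le.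
    by rewrite /unionF (leq_trans (size_undup _)).
  move=> w; rewrite mem_undup => /flattenP[_ /mapP[ws /trP[_ _ b] ->]]; exact: b.
have h3 : (Z * TT) * TT.+1 <= Y * Y * Y by rewrite !leq_mul //; lia.
exact: add_cube_le (leq_trans hZ lY1) (leq_trans le_k lY1) h3.
Qed.

Lemma fresh_runs_ok R : uniq R -> all good R ->
  fresh_runs B leaf_c trans_c clean_c k leafF trF clF (rules Aut) R.
Proof.
move=> uR hR; have le_prod rho p s : rho \in rules Aut ->
    pools R rho.1.2 = p ++ s -> size (prodl s) <= Z.
  move=> /rule_bounds[_ sz _] h; apply: leq_trans le_N.
  exact: size_prodl_pools uR hR sz h.
have hc : all good (flatten [seq cands leafF trF clF R rho | rho <- rules Aut]).
  apply/allP => e0 /flattenP[_ /mapP[rho hrho ->]].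
  exact: (allP (cands_entry hA hC hsigma leaf_lists tr_lists cl_lists hR hrho)).
split.
- by apply: leB; right; right; exact: leq_trans (size_good uR hR) le_NZ.
- by move=> e0 /(allP hR); exact: good_small.
- move=> rho hrho; have [_ sz _] := rule_bounds hrho; split.
  + by apply: leB; right; right; exact: leq_trans sz le_r.
  + by move=> p s /(le_prod _ _ _ hrho) h; apply: leB; right; right.
  + by move=> es hes i; exact: (@step_ok R rho es i hR hrho hes).
- have [lY _] := le_trans_budget e hZ; have [lX _] := le_clean_budget e hZ.
  have lZ := leq_trans lY lX.
  apply: leq_trans (_ : Z * Z <= _); last exact: (sqr_le_budget hZ lZ lZ).
  have [n _ h] := outA.
  have [_ _ szr _] := lam_size_enc_automaton (leq_trans (leq_addl _ _) h).
  apply: leq_trans (_ : size (rules Aut) * Z <= _); last by rewrite leq_mul2r szr orbT.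
  rewrite -(size_map (cands leafF trF clF R)); apply: size_flatten_le.
  by move=> _ /mapP[rho hrho ->]; rewrite size_map (le_prod rho [::]).
- move=> rho e0 hrho he0; apply: good_small; apply: (allP hc).
  by apply/flattenP; exists (cands leafF trF clF R rho); rewrite ?map_f.
Qed.

Lemma poly_clean_le a b : a <= Z -> b <= Z * Z -> poly e (a + b) <= CT.
Proof.
move=> ha hb; have [h _] := le_trans_budget e hZ; apply: poly_le.
by apply: add_cube_le; nia.
Qed.

Lemma check_runs_ok e0 : good e0 ->
  check_runs B final_c inv_c k pc (fun i => final (Cs i) k) invF
    (accF k Cs c invF) e0.
Proof.
move=> he0; have /asboolP[t [ht hT]] := he0.
have htS : in_terms Sigma t by have [h _] := hA; apply: reaches_in_terms h ht.
have hw i : wit_set (Cs i) k (Dyn (Cs i) k t) by apply: wit_Dyn; rewrite ?hsigma.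
have [_ hb] := good_bounds he0.
have runi i : outputs CT (apps (p_inv (pC i)) [:: enc_nat k; enc_words (e0.2 i)])
    (enc_word (invF i (e0.2 i))).
  have [n ev le_n] := ip_inv (pol i) (hw i) (hT i).
  exists n; first by rewrite (invFE (hw i) (hT i)).
  rewrite (invFE (hw i) (hT i)); apply: leq_trans le_n _; apply: poly_clean_le => //.
  have [b1 b2] := hb i; apply: leq_trans (words_size_le b1 b2) _.
  by rewrite leq_mul //; [exact: leq_trans (hM i) le_MZ|have := hbeta i; lia].
split.
- exact: good_small.
- move=> i w hw0.
  have hww : wit (Cs i) k w by apply: (hw i); have /listsP[_ <-] := hT i.
  have [||h _] := @outputs_red _ _ (A (A (C (final_c i)) (C (enat k))) (C (eword w)))
    _ (ebool (final (Cs i) k w)) (ip_final (pol i) hww).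
  + by rewrite -vl_eword.
  + by [].
  apply: red_le h _; rewrite -(pw_B B); apply: leB; right; left.
  apply: poly_clean_le => //; have [_ /(_ _ hw0) b] := hb i.
  by apply: leq_trans (leq_trans b (hbeta i)) _; nia.
- move=> i; have [||h _] := @outputs_red _ _
    (A (A (C (inv_c i)) (C (enat k))) (C (ewords (e0.2 i))))
    _ (eword (invF i (e0.2 i))) (runi i).
  + by rewrite -vl_ewords.
  + exact: vl_eword.
  by apply: red_le h _; rewrite -(pw_B B); apply: leB; right; left.
- have [_ /(_ [tuple has (final (Cs i) k) (e0.2 i) | i < m]
             [tuple invF i (e0.2 i) | i < m]) out] := polc.
  have [||h _] := @outputs_red _ _
    (A (A (C pc)
          (C (eseq [seq ebool (has (final (Cs i) k) (e0.2 i)) | i <- enum 'I_m])))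
       (C (eseq [seq eword (invF i (e0.2 i)) | i <- enum 'I_m])))
    _ (ebool (accF k Cs c invF e0.2)) out.
  + rewrite /apps /=; congr (App (App _ (enc_seq _)) (enc_seq _)).
      by rewrite -!map_comp.
    by rewrite -!map_comp; apply: eq_map => i; apply: vl_eword.
  + by [].
  apply: red_le h _; rewrite -(pw_B B).
  have [_ _ h] := le_budget e hZ; apply: leq_trans h; apply: poly_le.
  (* An invariant is no longer than the time that [p_inv] takes to write it. *)
  have sz w : w \in [tuple invF i (e0.2 i) | i < m] -> size w <= CT.
    case/mapP=> i _ ->; have [n _ b] := runi i.
    apply: leq_trans (lam_size_enc_word _) _; exact: leq_trans (leq_addl _ _) b.
  have := words_size_le (leqnn _) sz; rewrite size_tuple => h.
  have [lY1 lY2] := le_trans_budget e hZ; have [lX1 lX2] := le_clean_budget e hZ.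
  have h' : m * CT.+1 <= X * X by rewrite leq_mul //; lia.
  have h3 : X ^ 3 = X * X * X by rewrite !expnS expn0; lia.
  rewrite h3; have : X * X * 64 <= X * X * X by rewrite leq_mul2l; lia.
  have hm : m <= X * X.
    apply: leq_trans (leq_trans le_m (leq_trans lY1 lX1)) _.
    by rewrite leq_pmulr //; lia.
  move=> h4; apply: leq_trans (leq_add hm (leq_trans h h')) _.
  by apply: leq_trans h4; lia.
Qed.
End Fun.

Lemma level_decided (incl : Prop) :
  (incl <-> forall t, d_lang D k t -> accepted (combination (d_sigma D) c Cs) k t) ->
  exists2 b : bool, b <-> incl &
  red (pw B 34)
    (A (A (A (A (C decide_v) (C pA))
       (C (ecores wit_c leaf_c trans_c final_c clean_c inv_c))) (C pc)) (C (enat k)))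
    (C (ebool b)).
Proof.
move=> hincl.
have [leafF hleaf] := cond_choice2 [::] leaf_run.
have [trF htr] := cond_choice3 [::] trans_run.
have [clF hcl] := cond_choice2 [::] clean_run.
have [n _ h] := outA.
have [_ sf sr _] := lam_size_enc_automaton (leq_trans (leq_addl _ _) h).
have ZB := Z_le_budget e hZ.
have lv i a : a \in Sigma -> arity a = 0 -> lists (leafF i a) (trans (Cs i) k a [::]).
  by move=> ha a0; have [] := hleaf i a (conj ha a0).
have tv i a ws : a \in Sigma -> 0 < arity a -> size ws = arity a ->
    all (wit (Cs i) k) ws -> lists (trF i a ws) (trans (Cs i) k a ws).
  by move=> ha a0 sz hw; have [] := htr i a ws (And4 ha a0 sz hw).
have cv i ws S : wit_set (Cs i) k S -> lists ws S -> lists (clF i ws) (clean (Cs i) k S).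
  move=> hS hws; have eS := lists_fsetE hws; rewrite eS in hS *.
  by have /listsP[u _] := hws; have [] := hcl i ws (conj u hS).
have iv i ws S : wit_set (Cs i) k S -> lists ws S -> invF i ws = Defs.inv (Cs i) k S.
  by move=> _ /lists_fsetE ->.
have [|R [aR fR run]] := @red_decide B hB m (leq_trans le_m ZB) wit_c leaf_c trans_c
  final_c clean_c inv_c k leafF trF clF (rules Aut) pc (final_states Aut)
  (fun i => final (Cs i) k) invF (accF k Cs c invF) pA (enat (nstates Aut)) good
  _ (leq_trans sr ZB) (leq_trans sf ZB)
  (fresh_runs_ok hleaf htr hcl)
  (fun R _ hR => fresh_entry hA hC hsigma lv tv cv hR) check_runs_ok.
  have [||hr _] := @outputs_red _ _ (A (C pA) (C (enat k))) _ (eaut Aut) outA => //.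
    exact: vl_eaut.
  by apply: red_le hr _; rewrite -(pw_B B).
exists (all (check (final_states Aut) (accF k Cs c invF)) R) => //.
by rewrite hincl; apply: (all_check c hA hC hsigma lv tv cv iv aR fR).
Qed.
End Level.

(** * Bounds for all levels *)

Section Domination.
Variable H : nat -> nat.
Hypothesis H_gt0 : forall k, 0 < H k.

(** O-notation with a visible exponent: j has to be a function of e alone, while the hidden factor
    may depend on all the data. *)
Definition dominated (j : nat) (X : nat -> nat) : Prop :=
  exists a, forall k, X k <= a * H k ^ j.

Lemma dominated_le j j' X : j <= j' -> dominated j X -> dominated j' X.
Proof.
move=> le_j [a ha]; exists a => k; apply: leq_trans (ha k) _.
by rewrite leq_mul2l leq_pexp2l ?orbT.
Qed.

Lemma dominated_add j j' X Y : dominated j X -> dominated j' Y ->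
  dominated (j + j') (fun k => X k + Y k).
Proof.
move=> /(dominated_le (leq_addr j' j))[a ha] /(dominated_le (leq_addl j j'))[b hb].
by exists (a + b) => k; rewrite mulnDl leq_add.
Qed.

Lemma dominated_exp j X n : dominated j X -> dominated (j * n) (fun k => X k ^ n).
Proof.
move=> [a ha]; exists (a ^ n) => k; rewrite expnM -expnMn.
by case: n => // n; rewrite leq_exp2r.
Qed.

Lemma dominated_poly e j X : dominated j X ->
  dominated (j * e) (fun k => poly e (X k)).
Proof.
move=> hX; have hX1 : dominated j (fun k => (X k).+1).
  have [a ha] := hX; exists a.+1 => k.
  by rewrite mulSn -add1n leq_add // expn_gt0 H_gt0.
have [a ha] := dominated_exp e hX1; exists (e * a) => k.
by rewrite /poly -mulnA leq_mul2l ha orbT.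
Qed.
End Domination.

(** The degree of [budget] when Z has degree j, computed stage by stage: sums add degrees and
    [poly e] multiplies them by e. *)
Definition budget_exp (e j : nat) : nat :=
  let j1 := j + j * 3 * e in let j2 := j1 + j1 * 5 * e in j2 * 2 + j2 * 3 * e.

Lemma dominated_budget H e j Z : (forall k, 0 < H k) -> dominated H j Z ->
  dominated H (budget_exp e j) (fun k => budget e (Z k)).
Proof.
move=> hH hZ.
have h1 : dominated H (j + j * 3 * e) (fun k => trans_budget e (Z k)).
  apply: (dominated_add hH hZ).
  exact: (dominated_poly hH e (dominated_exp 3 hZ)).
have h2 := dominated_add hH h1 (dominated_poly hH e (dominated_exp 5 h1)).
have h3 := dominated_add hH (dominated_exp 2 h2)
  (dominated_poly hH e (dominated_exp 3 h2)).
exact: h3.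
Qed.

Fixpoint below_v (n : nat) : cval :=
  if n is n'.+1 then @clos (A (A (V 0) (C true_v)) (C (below_v n'))) erefl
  else @clos (C false_v) erefl.

(** The threshold is built into the program as n nested case distinctions, so the time does not
    depend on k. *)
Lemma red_below n k :
  red (3 * n + 1) (A (C (below_v n)) (C (enat k))) (C (ebool (k < n))).
Proof.
elim: n k => [|n IH] k.
  by apply: red_le (@red_clos_beta (C false_v) erefl (enat k)) _.
have h := @red_clos_beta (A (A (V 0) (C true_v)) (C (below_v n))) erefl (enat k).
case: k h => [|k] h; rewrite /= in h.
  by apply: red_le (red_trans h (@red_zero true_v (below_v n))) _; lia.
by apply: red_le (red_trans h (red_trans (@red_succ k true_v (below_v n)) (IH k))) _; lia.
Qed.

Lemma lam_size_enc_bool b : lam_size (enc_bool b) <= 4.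
Proof. by case: b. Qed.

(* A monotone predicate on nat is decided in constant time by comparison with
   its threshold, which need not be computable from the data. *)
Lemma antitone_decided (Q : nat -> Prop) :
  (forall k k', k <= k' -> Q k' -> Q k) ->
  exists t M, procedure M /\ forall k, decides_in t (App M (enc_nat k)) (Q k).
Proof.
move=> anti.
suff [p [t ht]] : exists (p : cval) t, forall k, exists2 b : bool, b <-> Q k &
    red t (A (C p) (C (enat k))) (C (ebool b)).
  exists (t + 4), (vl p); split; first exact: vlP.
  move=> k; have [b hb /red_eval[n le_n ev]] := ht k; exists b => //.
  by exists n => //; apply: leq_add le_n (lam_size_enc_bool b).
have [all_Q|not_all] := pselect (forall k, Q k).
  exists (@clos (C true_v) erefl), 1 => k; exists true; last exact: red_clos_beta.
  by split=> // _; apply: all_Q.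
have ex : exists k, ~~ `[< Q k >].
  by move/existsNP: not_all => [k nQ]; exists k; apply/asboolPn.
case: (ex_minnP ex) => k0 /asboolPn nQ min_k0.
exists (below_v k0), (3 * k0 + 1) => k; exists (k < k0); last exact: red_below.
split=> [lt_k|hQ].
  by apply: contrapT => /asboolPn /min_k0; rewrite leqNgt lt_k.
by rewrite ltnNge; apply/negP => le_k; apply: nQ; apply: anti le_k hQ.
Qed.

(** The exponent is at least beta unless another factor vanishes, which the hypotheses exclude for
    positive beta. *)
Lemma beta_le m r1 beta mu : (0 < beta -> 0 < mu) -> (0 < beta -> 0 < m) ->
  0 < r1 -> beta <= 2 ^ (m * r1 * beta * mu).
Proof.
move=> mu_gt0' m_gt0 r1_gt0.
have [->|b_gt0] := posnP beta; first by [].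
have h1 := mu_gt0' b_gt0; have h2 := m_gt0 b_gt0.
apply: leq_trans (ltnW (ltn_expl beta (ltnSn 1))) _; rewrite leq_pexp2l //.
rewrite mulnAC leq_pmull // !muln_gt0 h1 h2; lia.
Qed.

(** If mu > 1, the bound on mu forces beta > 0, hence m > 0, and mu^r1 <= 2^(mu r1) has a small
    enough exponent. Otherwise the left side is 1. *)
Lemma multiplicity_exp_le m r1 beta mu : (0 < beta -> 0 < m) ->
  mu <= 2 ^ beta.+1 - 1 -> maxn 1 mu ^ r1 <= 2 ^ (m * r1 * beta * mu).
Proof.
move=> m_gt0 le_mu; have [->|r1_gt0] := posnP r1; first by rewrite expn_gt0.
have [le1|lt1] := leqP mu 1.
  by rewrite exp1n expn_gt0.
have b_gt0 : 0 < beta by case: (beta) le_mu lt1 => //; lia.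
have h2 := m_gt0 b_gt0.
apply: leq_trans (_ : (2 ^ mu) ^ r1 <= _).
  by rewrite leq_exp2r // ltnW // ltn_expl.
rewrite -expnM leq_pexp2l //.
have -> : m * r1 * beta * mu = mu * r1 * (m * beta) by nia.
by rewrite leq_pmulr // muln_gt0 h2.
Qed.

(** For beta > 0 the factors K, beta and mu are at most 2^(K-4), 2^beta and 2^(beta+1), and K - 4 +
    2 beta + 1 <= K beta. The first estimate is proved from K = 8 on. *)
Lemma bound_exp_le m r1 beta mu K : mu <= 2 ^ beta.+1 - 1 -> 8 <= K ->
  2 ^ (K * (m * r1 * beta * mu)) <= 2 ^ (m * r1 * 2 ^ (K * beta)).
Proof.
move=> le_mu hK; rewrite leq_pexp2l //.
have -> : K * (m * r1 * beta * mu) = m * r1 * (K * beta * mu) by nia.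
rewrite leq_mul2l; apply/orP; right.
have [->|b_gt0] := posnP beta; first by rewrite muln0 mul0n.
have h1 : K <= 2 ^ (K - 4).
  have -> : K = (K - 8) + 8 by lia.
  elim: (K - 8) => //= n IH; rewrite !addSn subSn ?expnS; [lia|lia].
have h2 := ltnW (ltn_expl beta (ltnSn 1)).
have h3 : mu <= 2 ^ beta.+1 by lia.
apply: leq_trans (leq_mul (leq_mul h1 h2) h3) _.
by rewrite -!expnD leq_pexp2l //; nia.
Qed.

(** Here e + 2 is the degree of [base_size], 34 the exponent of the whole program in [red_decide],
    and 8 the least value that [bound_exp_le] accepts. *)
Definition time_exp (e : nat) : nat := budget_exp e (e + 2) * 34 + 8.

Section Main.
Variables (e r : nat) (f : nat -> nat) (D : decomposition).
Variables (Aut : nat -> tree_automaton) (pA : cval).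
Variables (m : nat) (Cs : 'I_m -> core) (pC : 'I_m -> core_program).
Variables (c : combinator m) (pc : cval).
Hypothesis hD : treelike_class r D.
Hypothesis hA : automation_with e r f D Aut (vl pA).
Hypothesis hC : forall i, treelike_dp_core (Cs i).
Hypothesis fC : forall i, finite_core (Cs i).
Hypothesis pol : forall i, internally_polynomial_with e (Cs i) (pC i).
Hypothesis coh : forall i, coherent (Cs i) D.
Hypothesis polc : polynomial_combinator_with e c (vl pc).

Local Notation r1 := (maxn 1 r).
Definition beta k := \max_(i < m) bitlength_sup (Cs i) k.
Definition mu k := \max_(i < m) multiplicity_sup (Cs i) k.
(** The yardstick for all costs: its K-th power is (k+1)^K times the bound of the theorem. *)
Definition growth k := k.+1 * (f k ^ r1 * 2 ^ (m * r1 * beta k * mu k)).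
(** Replaces (beta + 1) mu in the exponent by a multiple of beta mu: for beta > 0 by beta + 1 <= 2
    beta, while for beta = 0 there is mu <= 1 and the leading factor 2 suffices. *)
Definition tuples_bound k := 2 * 2 ^ (2 * (beta k * mu k)).
Definition entries_bound k := f k * tuples_bound k ^ m.
Definition base_size k :=
  64 + k + m + r1 + (beta k).+1 + poly e k * f k ^ (e * r1) +
  maxn 1 (mu k) ^ r1 + entries_bound k ^ r1.

(** If f k were 0, the time allowed for writing the automaton would be 0, as the exponent
    [e * maxn 1 r] is positive unless e = 0, and then [poly e k] vanishes. Every encoding has
    positive size. *)
Lemma f_gt0 k : 0 < f k.
Proof.
have [_ /(_ k)[_ _ [n _ h]]] := hA; rewrite lt0n; apply/eqP => f0; move: h.
rewrite f0 /enc_automaton /enc_tuple /=; case: (e) => [|e']; first by rewrite /poly; lia.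
by rewrite exp0n ?muln0 ?muln_gt0 ?leq_max //; lia.
Qed.

Lemma r1_gt0 : 0 < r1. Proof. by rewrite leq_max. Qed.

Lemma beta_le_max k i : bitlength_sup (Cs i) k <= beta k.
Proof. exact: (leq_bigmax (F := fun i => bitlength_sup (Cs i) k)). Qed.

Lemma mu_le_max k i : multiplicity_sup (Cs i) k <= mu k.
Proof. exact: (leq_bigmax (F := fun i => multiplicity_sup (Cs i) k)). Qed.

Lemma max_m_gt0 k : 0 < beta k -> 0 < m.
Proof. by rewrite /beta; case: m Cs => // C'; rewrite big_ord0. Qed.

Lemma max_mu_gt0 k : 0 < beta k -> 0 < mu k.
Proof.
rewrite !lt0n; apply: contra => /eqP mu0; rewrite -leqn0.
apply/bigmax_leqP => i _; rewrite leqNgt; apply/negP => /(mu_gt0 (fC i)).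
by have := mu_le_max k i; rewrite mu0 leqn0 => /eqP ->.
Qed.

Lemma max_mu_le k : mu k <= 2 ^ (beta k).+1 - 1.
Proof.
apply/bigmax_leqP => i _; apply: leq_trans (mu_le k (fC i)) _.
by rewrite leq_sub2r // leq_pexp2l // ltnS beta_le_max.
Qed.

Lemma tuples_le k i :
  2 ^ ((bitlength_sup (Cs i) k).+1 * multiplicity_sup (Cs i) k) <= tuples_bound k.
Proof.
rewrite /tuples_bound -expnS leq_pexp2l //.
have h1 := beta_le_max k i; have h2 := mu_le_max k i; have h3 := mu_le k (fC i).
have [b0|b_gt0] := posnP (bitlength_sup (Cs i) k).
  by rewrite b0 mul1n; apply: leq_trans h3 _; rewrite b0.
apply: leq_trans (_ : 2 * (bitlength_sup (Cs i) k * multiplicity_sup (Cs i) k) <= _).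
  by rewrite mulnA leq_mul2r; apply/orP; right; lia.
by apply: leqW; rewrite leq_mul2l /= leq_mul.
Qed.

Lemma growth_gt0 k : 0 < growth k.
Proof. by rewrite /growth !muln_gt0 /= !expn_gt0 f_gt0. Qed.

(** The factor 2^(m r1) comes from the 2 in [tuples_bound]; it does not depend on k and ends up in
    the constant [a]. The square comes from the 2 in its exponent. *)
Lemma entries_le k : entries_bound k ^ r1 <= 2 ^ (m * r1) * growth k ^ 2.
Proof.
set G := 2 ^ (m * r1 * beta k * mu k).
have -> : entries_bound k ^ r1 = 2 ^ (m * r1) * (f k ^ r1 * (G * G)).
  rewrite /entries_bound /tuples_bound !expnMn -!expnM mulnCA; congr (_ * (_ * _)).
  by rewrite /G -expnD; congr (2 ^ _); nia.
rewrite leq_mul2l; apply/orP; right; rewrite /growth -/G expnS expn1.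
have h1 : 0 < f k ^ r1 by rewrite expn_gt0 f_gt0.
apply: leq_trans (_ : (f k ^ r1 * G) * (f k ^ r1 * G) <= _); first by nia.
by rewrite leq_mul // leq_pmull.
Qed.

(** The exponent e + 2 serves two summands: the automaton takes time at most e times [growth] to the
    e, and [entries_le] brings a square. The constant has one term for each summand of
    [base_size]. *)
Lemma dominated_base : dominated growth (e + 2) base_size.
Proof.
exists (64 + 1 + m + r1 + 2 + e + 1 + 2 ^ (m * r1)) => k.
set H := growth k ^ (e + 2).
have gt0 := growth_gt0 k; have H1 j : j <= e + 2 -> growth k ^ j <= H.
  by move=> le_j; rewrite leq_pexp2l.
have H_ge1 : 1 <= H by rewrite expn_gt0 gt0.
have h1 : growth k <= H by rewrite -{1}(expn1 (growth k)) H1 // addn2.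
have hG : 2 ^ (m * r1 * beta k * mu k) <= growth k.
  by rewrite /growth mulnA leq_pmull // muln_gt0 expn_gt0 f_gt0.
have hf : f k ^ r1 * k.+1 <= growth k.
  by rewrite /growth mulnC leq_mul2l leq_pmulr ?orbT // expn_gt0.
have h2 : k <= H.
  apply: leq_trans h1; apply: leq_trans hf; apply: leq_trans (leqnSn k) _.
  by rewrite leq_pmull // expn_gt0 f_gt0.
have h3 : (beta k).+1 <= 2 * H.
  have hb := leq_trans (beta_le (@max_mu_gt0 k) (@max_m_gt0 k) r1_gt0)
    (leq_trans hG h1).
  by move: hb H_ge1; set b := beta k; clear; lia.
have h4 : poly e k * f k ^ (e * r1) <= e * H.
  rewrite /poly -mulnA leq_mul2l; apply/orP; right.
  apply: leq_trans (H1 e _); last by rewrite leq_addr.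
  rewrite mulnC (mulnC e) expnM -expnMn.
  by case: (e) => // e'; rewrite leq_exp2r.
have h5 := multiplicity_exp_le r1 (@max_m_gt0 k) (max_mu_le k).
have h6 : entries_bound k ^ r1 <= 2 ^ (m * r1) * H.
  apply: leq_trans (entries_le k) _; rewrite leq_mul2l H1 ?orbT //.
  by rewrite leq_addl.
rewrite /base_size !mulnDl !mul1n.
by repeat apply: leq_add => //; [lia|nia|nia|lia].
Qed.

Lemma level_time k (incl : Prop) :
  (incl <-> forall t, d_lang D k t -> accepted (combination (d_sigma D) c Cs) k t) ->
  decides_in (pw (budget e (base_size k)) 34 + 4)
    (apps (vl decide_v) [:: vl pA; enc_core_programs pC; vl pc; enc_nat k]) incl.
Proof.
move=> hincl; have [_ /(_ k)[hrec hns hout]] := hA.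
have out : outputs (base_size k) (App (vl pA) (enc_nat k)) (enc_automaton (Aut k)).
  by have [n ev le_n] := hout; exists n => //; apply: leq_trans le_n _; rewrite /base_size; lia.
have h64 : 64 <= base_size k by rewrite /base_size -!addnA leq_addr.
have hk : k <= base_size k by rewrite /base_size; lia.
have hm : m <= base_size k by rewrite /base_size; lia.
have hr : r1 <= base_size k by rewrite /base_size; lia.
have hb : beta k < base_size k by rewrite /base_size; lia.
have hM : maxn 1 (mu k) ^ r1 <= base_size k by rewrite /base_size; lia.
have hN : entries_bound k ^ r1 <= base_size k by rewrite /base_size; lia.
have hMi i : multiplicity_sup (Cs i) k <= maxn 1 (mu k).
  by rewrite leq_max mu_le_max orbT.
have M_gt0 : 0 < maxn 1 (mu k) by rewrite leq_max.
have hNs : nstates (Aut k) * tuples_bound k ^ m <= entries_bound k.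
  by rewrite /entries_bound leq_mul2r hns orbT.
have N_gt0 : 0 < entries_bound k.
  by rewrite /entries_bound muln_gt0 f_gt0 expn_gt0 muln_gt0 /= expn_gt0.
have [b hbi /red_eval[n le_n ev]] := level_decided hD hrec out hC fC pol coh polc
  h64 hk hm hr hb (beta_le_max k) hMi M_gt0 hM (tuples_le k) hNs N_gt0 hN hincl.
exists b => //; exists n; last by apply: leq_add le_n (lam_size_enc_bool b).
move: ev; congr (eval _ (App (App (App _ _) _) _) _).
by rewrite /ecores /enc_core_programs /= -map_comp; congr enc_seq; apply: eq_map.
Qed.

Lemma time_dominated : exists a, forall k,
  pw (budget e (base_size k)) 34 + 4 <= a * growth k ^ time_exp e.
Proof.
have [a ha] := dominated_exp 34 (dominated_budget e growth_gt0 dominated_base).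
exists (a + 4) => k; rewrite mulnDl; apply: leq_add; last first.
  by rewrite leq_pmulr // expn_gt0 growth_gt0.
apply: leq_trans (ha k) _; rewrite leq_mul2l leq_pexp2l ?orbT ?growth_gt0 //.
by rewrite /time_exp leq_addr.
Qed.
End Main.

Theorem theorem9 :
  exists U : lam, procedure U /\
  forall e : nat, exists K : nat,
  forall (r : nat) (f : nat -> nat) (D : decomposition)
    (A : nat -> tree_automaton) (pA : lam)
    (m : nat) (C : 'I_m -> core) (pC : 'I_m -> core_program)
    (c : combinator m) (pc : lam),
  treelike_class r D ->
  automation_with e r f D A pA ->
  (forall i, treelike_dp_core (C i)) ->
  (forall i, finite_core (C i)) ->
  (forall i, internally_polynomial_with e (C i) (pC i)) ->
  (forall i, coherent (C i) D) ->
  polynomial_combinator_with e c pc ->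
  let inclusion k :=
    forall G, class_property D k G ->
      core_property (combination (d_sigma D) c C) D G in
  let beta k := \max_(i < m) bitlength_sup (C i) k in
  let mu k := \max_(i < m) multiplicity_sup (C i) k in
  let r1 := maxn 1 r in
  let bound k := f k ^ (K * r1) * 2 ^ (K * (m * r1 * beta k * mu k)) in
  exists a : nat,
  [/\ (* one algorithm U, given programs for all the data, decides inclusion *)
      forall k,
        decides_in (a * k.+1 ^ K * bound k)
          (apps U [:: pA; enc_core_programs pC; pc; enc_nat k])
          (inclusion k),
      (* for fixed data, the factor polynomial in k can be dispensed with *)
      exists M : lam, procedure M /\
        forall k, decides_in (a * bound k) (App M (enc_nat k)) (inclusion k) &
      forall k,
        bound k <= f k ^ (K * r1) * 2 ^ (m * r1 * 2 ^ (K * beta k))].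
Proof.
exists (vl decide_v); split=> [|e]; first exact: vlP.
exists (time_exp e) => r f D A pA m C pC c pc hD hA hC fC pol coh polc.
move=> inclusion beta0 mu0 r1 bound.
have [procA _] := hA; have [procc _] := polc.
pose vA := CVal procA; pose vc := CVal procc.
have incE k := @inclusionE D k m c C coh.
have [a ha] := @time_dominated e r f D A vA m C hA fC.
have [|t [M [procM hM]]] := @antitone_decided inclusion.
  by move=> k k' le_k; apply: inclusion_antitone hD le_k.
have bound_gt0 k : 0 < bound k.
  by rewrite muln_gt0 !expn_gt0 (@f_gt0 e r f D A vA hA k).
have mono s Q t1 t2 : t1 <= t2 -> decides_in t1 s Q -> decides_in t2 s Q.
  by move=> le_t [b hb [n ev le_n]]; exists b => //; exists n => //; apply: leq_trans le_n _.
(* [a] comes from the uniform algorithm and t from the threshold program; their sum serves both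
   claims. *)
exists (a + t); split.
- move=> k; apply: mono (@level_time e r f D A vA m C pC c vc hD hA hC fC pol coh
    polc k _ (incE k)).
  have growthE : growth r f C k ^ time_exp e = k.+1 ^ time_exp e * bound k.
    by rewrite /growth !expnMn -!expnM; congr (_ * (_ ^ _ * 2 ^ _)); apply: mulnC.
  by apply: leq_trans (ha k) _; rewrite growthE -mulnA leq_mul2r leq_addr orbT.
- exists M; split=> // k; apply: mono (hM k).
  by rewrite mulnDl -[t in t <= _]muln1; apply: leq_trans (leq_addl _ _);
    rewrite leq_mul2l bound_gt0 orbT.
- move=> k; rewrite leq_mul2l; apply/orP; right; apply: bound_exp_le.
  + exact: max_mu_le.
  + by rewrite /time_exp leq_addl.
Qed.
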